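(* For any fixed odd positive integer $d$, the pseudoconvexity of polynomials of degree $d$ can be checked in polynomial time; that is, there is an algorithm which, given a polynomial $p$ of degree $d$ in $n$ real variables ($n$ is part of the input) with rational coefficients, correctly decides whether $p$ is pseudoconvex, in time polynomial in the number of bits of the input.
   Context: A differentiable function $f:\mathbb{R}^n\to\mathbb{R}$ is pseudoconvex if for all $x,y\in\mathbb{R}^n$ the implication $\nabla f(x)^T(y-x)\ge 0\ \Rightarrow\ f(y)\ge f(x)$ holds. An input polynomial is given by the ordered list of its (rational) coefficients, and input size is the number of bits of this list. *)

(* Defs.v *)
From HB Require Import structures.
From mathcomp Require Import all_boot all_order all_algebra.
(* The notations of mpoly clash with those of mathcomp-analysis; without them,
   {mpoly R[n]} is written mpoly n R. *)
From mathcomp Require Import -(notations) mpoly.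
From mathcomp Require Import all_classical all_reals all_analysis.

Set Implicit Arguments.
Unset Strict Implicit.
Unset Printing Implicit Defensive.

Import Order.TTheory GRing.Theory Num.Theory.
Import numFieldNormedType.Exports.

Local Open Scope ring_scope.

Definition gradient (R : realType) (n : nat) (f : 'rV[R]_n -> R)
  (x : 'rV[R]_n) : 'rV[R]_n := \row_i 'D_(delta_mx 0 i) f x.

Definition dotp (R : realType) (n : nat) (u v : 'rV[R]_n) : R :=
  \sum_(i < n) u 0 i * v 0 i.

Definition pseudoconvex (R : realType) (n : nat) (f : 'rV[R]_n -> R) : Prop :=
  (forall x, differentiable f x) /\
  (forall x y, 0 <= dotp (gradient f x) (y - x) -> f x <= f y).

Definition polyfun (R : realType) (n : nat) (p : mpoly n rat) :
  'rV[R]_n -> R :=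
  fun x => meval (fun i => x 0 i) (map_mpoly (@ratr R) p).
Arguments polyfun R {n} p.

(* ** Input format

   A monomial X_{i_1} ... X_{i_k} is the nondecreasing word [:: i_1; ..; i_k];
   mon_words n lo k lists, lexicographically, those with lo <= i_1 and
   i_k < n. *)
Fixpoint mon_words (n lo k : nat) : seq (seq nat) :=
  if k is k'.+1 then
    flatten [seq [seq i :: w | w <- mon_words n i k'] | i <- iota lo (n - lo)]
  else [:: [::]].

Definition mnm_of_word (n : nat) (w : seq nat) : multinom n :=
  Multinom [tuple count_mem (i : nat) w | i < n].

(* All monomials of degree at most d, in the order
   1, X_0, .., X_{n-1}, X_0^2, X_0 X_1, .., X_{n-1}^2, X_0^3, .. *)
Definition monomials (n d : nat) : seq (multinom n) :=
  [seq mnm_of_word n w | w <- flatten [seq mon_words n 0 k | k <- iota 0 d.+1]].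

(* n, followed by numerator and denominator (in lowest terms) of every
   coefficient, zero coefficients included. *)
Definition encode_poly (d n : nat) (p : mpoly n rat) : seq int :=
  n%:Z :: flatten [seq [:: numq (mcoeff m p); denq (mcoeff m p)]
                  | m <- monomials n d].

(* ** Random access machines with logarithmic cost

   This is the RAM of Aho, Hopcroft and Ullman, with three-address instructions
   instead of an accumulator, without division, with the input in a read-only
   random access array, and with a multiplication charged the product, rather
   than the sum, of the costs of its operands. It is polynomially
   equivalent to multitape Turing machines. *)

(* floor(log_2 |z|) + 1, and 1 for z = 0 *)
Definition bitlen (z : int) : nat := (trunc_log 2 `|z|).+1.

Definition input_size (w : seq int) : nat := \sum_(z <- w) bitlen z.

Inductive location :=
  | Dir of nat   (* register j *)
  | Ind of nat.  (* the register whose index is the content of register j *)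

Inductive operand :=
  | Const of int
  | Loc of location.

Inductive arith := AddOp | SubOp | MulOp.

Inductive instr :=
  | Op of arith & location & operand & operand  (* destination first *)
  | Inp of location & operand                   (* read an input cell *)
  | Jgtz of operand & nat                       (* jump if positive *)
  | Halt of bool.

Definition program := seq instr.

Definition regs := nat -> int.

(* program counter and registers *)
Definition config := (nat * regs)%type.

(* Indices are absolute values, so that a negative index is not an error. *)
Definition loc_index (r : regs) (a : location) : nat :=
  match a with
  | Dir j => j
  | Ind j => `|r j|%N
  end.

Definition op_value (r : regs) (o : operand) : int :=
  match o with
  | Const z => z
  | Loc a => r (loc_index r a)
  end.

Definition arith_value (f : arith) (x y : int) : int :=
  match f with
  | AddOp => x + y
  | SubOp => x - y
  | MulOp => x * y
  end.

Definition set_reg (r : regs) (a : location) (v : int) : regs :=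
  let j := loc_index r a in fun k => if k == j then v else r k.

(* Cells beyond the end of the input read as 0. *)
Definition input_value (w : seq int) (r : regs) (o : operand) : int :=
  nth 0 w `|op_value r o|%N.

Definition step (w : seq int) (i : instr) (c : config) : config + bool :=
  let: (pc, r) := c in
  match i with
  | Op f a x y =>
      inl (pc.+1, set_reg r a (arith_value f (op_value r x) (op_value r y)))
  | Inp a x => inl (pc.+1, set_reg r a (input_value w r x))
  | Jgtz x l => inl (if 0 < op_value r x then l else pc.+1, r)
  | Halt b => inr b
  end.

Definition loc_cost (r : regs) (a : location) : nat :=
  match a with
  | Dir j => bitlen j
  | Ind j => (bitlen j + bitlen (r j))%N
  end.

Definition op_cost (r : regs) (o : operand) : nat :=
  match o with
  | Const z => bitlen z
  | Loc a => (loc_cost r a + bitlen (op_value r o))%N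
  end.

Definition arith_cost (f : arith) (m n : nat) : nat :=
  match f with
  | AddOp | SubOp => (m + n)%N
  | MulOp => (m * n)%N
  end.

Definition step_cost (w : seq int) (i : instr) (c : config) : nat :=
  let: (pc, r) := c in
  match i with
  | Op f a x y => (arith_cost f (op_cost r x) (op_cost r y) + loc_cost r a)%N
  | Inp a x => (op_cost r x + bitlen (input_value w r x) + loc_cost r a)%N
  | Jgtz x l => op_cost r x
  | Halt b => 1%N
  end.

(* halts P w c t b: on input w, the program P started in configuration c halts
   with answer b after instructions of total cost t. There is no rule for a
   program counter outside of P: such a run never halts. *)
Inductive halts (P : program) (w : seq int) : config -> nat -> bool -> Prop :=
  | halts_now c i b :
      onth P c.1 = Some i -> step w i c = inr b ->
      halts P w c (step_cost w i c) b
  | halts_step c i c' t b :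
      onth P c.1 = Some i -> step w i c = inl c' -> halts P w c' t b ->
      halts P w c (step_cost w i c + t) b.

Definition init_config : config := (0%N, fun=> 0).

(* The program P decides Q on the inputs enc x, x : X, in polynomial time. *)
Definition decides_in_polytime (X : Type) (enc : X -> seq int) (Q : X -> Prop)
    (P : program) : Prop :=
  exists c k : nat, forall x : X, exists (t : nat) (b : bool),
    [/\ halts P (enc x) init_config t b,
        (t <= c * input_size (enc x) ^ k)%N
      & b <-> Q x].

Record poly_of_degree (d : nat) := PolyOfDegree {
  nvars : nat;
  poly_val :> mpoly nvars rat;
  (* msize is the total degree plus one, and 0 for the zero polynomial *)
  poly_deg : mpoly.msize poly_val = d.+1 }.

(* Main.v *)
(* Let p be pseudoconvex of odd degree d, with leading form p_d. On a line in a
   direction v with p_d(v) <> 0 the polynomial has odd degree, hence no minimum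
   and so no critical point; therefore D_v p(x) has the sign of p_d(v) at every
   x. Applying this to v - s u, for a fixed u with p_d(u) > 0 and varying s,
   shows that the ratio D_v p(x) / D_u p(x) does not depend on x: the gradient
   has a constant direction xi, and p(x) = h(xi . x) with h' free of real zeros.
   The converse is immediate.

   With xi normalized by xi_I = 1, the partial derivatives of p at 0 satisfy
   d^m p(0) = h^(|m|)(0) xi^m, and xi_j = B_j / B_I where B_j is the derivative
   along x_I^(d-1) x_j. For every I, a program can thus read off the B_j and the
   derivatives of h in one pass over the coefficients, and test these equations
   in a second one. For fixed d, the absence of real roots of h' is
   decided by a Sturm sequence that unfolds into one arithmetic expression of
   constant size. All stored numbers are input numbers up to constant factors,
   and only polynomially many instructions are executed. *)
Require Import Defs.
From HB Require Import structures.
From mathcomp Require Import all_boot all_order all_algebra.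
From mathcomp Require Import -(notations) mpoly.
From mathcomp Require Import all_classical all_reals all_analysis.
From mathcomp Require Import polyorder polyrcf qe_rcf_th.
From mathcomp Require Import zify ring.

Set Implicit Arguments.
Unset Strict Implicit.
Unset Printing Implicit Defensive.

Import Order.TTheory GRing.Theory Num.Theory.
Import numFieldNormedType.Exports.

Local Open Scope nat_scope.

(** * A while language on the random access machine *)

(** What depends on n becomes a loop of the program; what depends on d alone is unfolded into
    expressions. These have no branches: a conditional is arithmetic with 0/1 values. The value of a
    fixed expression has at most a constant times as many bits as the stored numbers, so the
    logarithmic cost is under control once the stored numbers are. Finding the coefficient of a
    given monomial in the input would require the rank of its word. This is avoided by k nested
    loops, k <= d, which run through the words in the order of the input, so that a pointer advanced
    by 2 always points at the coefficient of the current word. The derivatives along x_I^k and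
    x_I^(d-1) x_j must all be known before the equations are tested, whence two passes. The machine
    has no division, so all equations are cross-multiplied. The argument on gradients uses only
    polynomials on lines over a real closed field. The equations between derivatives at 0 hold over
    R iff they hold over Q; only the condition on real roots refers to R. *)

Lemma bitlen_leE (z : int) (k : nat) : 0 < k -> (bitlen z <= k) = (`|z| < 2 ^ k).
Proof.
move=> k0; rewrite /bitlen; have [z0|z0] := posnP `|z|.
  by rewrite z0 trunc_log0 k0 expn_gt0.
apply/idP/idP => h.
  by apply: leq_trans (trunc_log_ltn `|z| (isT : 1 < 2)) _; rewrite leq_exp2l.
by rewrite -(ltn_exp2l _ _ (isT : 1 < 2)); apply: leq_ltn_trans h; exact: trunc_logP.
Qed.

Lemma bitlen_gt0 z : 0 < bitlen z. Proof. by []. Qed.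

Lemma abs_lt_bitlen z : `|z| < 2 ^ bitlen z.
Proof. by rewrite -bitlen_leE. Qed.

Lemma bitlenM (x y : int) : bitlen (x * y)%R <= bitlen x + bitlen y.
Proof.
by rewrite bitlen_leE// abszM expnD ltn_mul// abs_lt_bitlen.
Qed.

(** Both lengths a, b are at least 1, whence 2^a + 2^b <= 2^(a+b). The bound is coarse so that all
    three operations obey the same one. *)
Lemma bitlenD (x y : int) : bitlen (x + y)%R <= bitlen x + bitlen y.
Proof.
rewrite bitlen_leE//; apply: leq_ltn_trans (_ : `|x| + `|y| < _); first by lia.
have := abs_lt_bitlen x; have := abs_lt_bitlen y.
rewrite expnD; have := expn_gt0 2 (bitlen x).-1; have := expn_gt0 2 (bitlen y).-1.
rewrite -(prednK (bitlen_gt0 x)) -(prednK (bitlen_gt0 y)) !expnS /=; nia.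
Qed.

Lemma bitlenB (x y : int) : bitlen (x - y)%R <= bitlen x + bitlen y.
Proof. by rewrite (_ : bitlen y = bitlen (- y)%R) ?bitlenD// /bitlen abszN. Qed.

Lemma bitlen_nat (m : nat) : bitlen m <= m.+1.
Proof. by rewrite bitlen_leE// (leq_ltn_trans (leqnSn m))// ltn_expl. Qed.

Inductive expr :=
  | Cst of int
  | Get of expr
  | InputAt of expr
  | IsPos of expr
  | Bin of arith & expr & expr.

Inductive stmt :=
  | Put of expr & expr
  | Seq of stmt & stmt
  | While of expr & stmt.

Definition store := nat -> int.

Definition upd (s : store) (j : nat) (v : int) : store :=
  fun k => if k == j then v else s k.

Fixpoint evale (w : seq int) (s : store) (e : expr) : int :=
  match e with
  | Cst z => z
  | Get e => s `|evale w s e|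
  | InputAt e => nth 0%R w `|evale w s e|
  | IsPos e => if (0 < evale w s e)%R then 1%R else 0%R
  | Bin f e1 e2 => arith_value f (evale w s e1) (evale w s e2)
  end.

(* Steps are assignments and loop tests; only values of at most L bits may be
   stored. *)
Inductive exec (w : seq int) (L : nat) : stmt -> store -> nat -> store -> Prop :=
  | exec_put s e1 e2 : bitlen (evale w s e2) <= L ->
      exec w L (Put e1 e2) s 1 (upd s `|evale w s e1| (evale w s e2))
  | exec_seq s s1 s2 c1 c2 t1 t2 : exec w L c1 s t1 s1 -> exec w L c2 s1 t2 s2 ->
      exec w L (Seq c1 c2) s (t1 + t2) s2
  | exec_while0 s e c : ~~ (0 < evale w s e)%R -> exec w L (While e c) s 1 s
  | exec_while1 s s1 s2 e c t1 t2 : (0 < evale w s e)%R ->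
      exec w L c s t1 s1 -> exec w L (While e c) s1 t2 s2 ->
      exec w L (While e c) s (t1 + t2).+1 s2.

(** One measure for three purposes: it bounds the length of the code of [e], the number of
    temporaries used, and the factor by which the bit length of the value can exceed that of the
    stored numbers. *)
Fixpoint esize (e : expr) : nat :=
  match e with
  | Cst z => bitlen z
  | Get e => (esize e).+2
  | InputAt e => (esize e).+1
  | IsPos e => (esize e).+4
  | Bin _ e1 e2 => (esize e1 + esize e2).+1
  end.

Fixpoint ssize (c : stmt) : nat :=
  match c with
  | Put e1 e2 => (esize e1 + esize e2).+4
  | Seq c1 c2 => ssize c1 + ssize c2
  | While e c => (esize e + ssize c).+4
  end.

(* Cell j of the store is register 2j; odd registers hold temporaries. *)
Definition tmp (t : nat) : nat := t.*2.+1.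
Definition tmpo (t : nat) : operand := Loc (Dir (tmp t)).

Fixpoint clen (e : expr) : nat :=
  match e with
  | Cst _ => 1
  | Get e => (clen e).+2
  | InputAt e => (clen e).+1
  | IsPos e => (clen e).+4
  | Bin _ e1 e2 => (clen e1 + clen e2).+1
  end.

(* The code at address a leaves the value of e in temporary t and does not
   touch the temporaries below t. *)
Fixpoint ecode (a t : nat) (e : expr) : seq instr :=
  match e with
  | Cst z => [:: Op AddOp (Dir (tmp t)) (Const z) (Const 0)]
  | Get e => ecode a t e ++
      [:: Op AddOp (Dir (tmp t)) (tmpo t) (tmpo t);
          Op AddOp (Dir (tmp t)) (Loc (Ind (tmp t))) (Const 0)]
  | InputAt e => ecode a t e ++ [:: Inp (Dir (tmp t)) (tmpo t)]
  | IsPos e => let b := a + clen e in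
      ecode a t e ++
      [:: Jgtz (tmpo t) b.+3;
          Op AddOp (Dir (tmp t)) (Const 0) (Const 0);
          Jgtz (Const 1) b.+4;
          Op AddOp (Dir (tmp t)) (Const 1) (Const 0)]
  | Bin f e1 e2 =>
      ecode a t e1 ++ ecode (a + clen e1) t.+1 e2 ++
      [:: Op f (Dir (tmp t)) (tmpo t) (tmpo t.+1)]
  end.

Lemma size_ecode e a t : size (ecode a t e) = clen e.
Proof.
by elim: e a t => //= [e IH|e IH|e IH|f e1 IH1 e2 IH2] a t;
  rewrite !size_cat ?IH ?IH1 ?IH2 /=; lia.
Qed.

Lemma clen_esize e : clen e <= esize e.
Proof. by elim: e => //= *; lia. Qed.

Fixpoint slen (c : stmt) : nat :=
  match c with
  | Put e1 e2 => (clen e1 + clen e2).+2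
  | Seq c1 c2 => slen c1 + slen c2
  | While e c => (clen e + slen c).+3
  end.

Fixpoint scode (a : nat) (c : stmt) : seq instr :=
  match c with
  | Put e1 e2 =>
      ecode a 0 e1 ++ ecode (a + clen e1) 1 e2 ++
      [:: Op AddOp (Dir (tmp 0)) (tmpo 0) (tmpo 0);
          Op AddOp (Ind (tmp 0)) (tmpo 1) (Const 0)]
  | Seq c1 c2 => scode a c1 ++ scode (a + slen c1) c2
  | While e c =>
      let b := (a + clen e) in
      ecode a 0 e ++
      [:: Jgtz (tmpo 0) b.+2; Jgtz (Const 1) (b.+2 + slen c).+1] ++
      scode b.+2 c ++ [:: Jgtz (Const 1) a]
  end.

Lemma size_scode c a : size (scode a c) = slen c.
Proof.
by elim: c a => [e1 e2|c1 IH1 c2 IH2|e c IH] a /=;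
  rewrite !size_cat /= ?size_cat ?size_ecode ?IH ?IH1 ?IH2 /=; lia.
Qed.

Definition code_at (P : program) (a : nat) (l : seq instr) : Prop :=
  exists l1 l2, P = l1 ++ l ++ l2 /\ size l1 = a.

Lemma code_at_cat P a l1 l2 : code_at P a (l1 ++ l2) ->
  code_at P a l1 /\ code_at P (a + size l1) l2.
Proof.
move=> [m1 [m2 [-> <-]]]; split; first by exists m1, (l2 ++ m2); rewrite !catA.
by exists (m1 ++ l1), m2; rewrite !catA size_cat.
Qed.

Lemma code_at_cons P a i l : code_at P a (i :: l) ->
  onth P a = Some i /\ code_at P a.+1 l.
Proof.
move=> [m1 [m2 [-> <-]]]; split; first by elim: m1.
by exists (rcons m1 i), m2; rewrite cat_rcons size_rcons.
Qed.

(** * Correctness and cost of the compiled code *)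

Section simulation.
Variables (P : program) (w : seq int) (L : nat).

(** [halts] only speaks of complete runs, so a partial run from [c] to [c'] is described by its
    effect on them: every halting run from [c'] extends to one from [c] at an extra cost of at most
    [T]. *)
Definition run (T : nat) (c c' : config) : Prop :=
  forall t b, halts P w c' t b -> exists2 t', halts P w c t' b & t' <= T + t.

Lemma run_trans T1 T2 c1 c2 c3 :
  run T1 c1 c2 -> run T2 c2 c3 -> run (T1 + T2) c1 c3.
Proof.
move=> h1 h2 t b /h2[t2 /h1[t1 h le1] le2]; exists t1 => //; lia.
Qed.

Lemma run_le T1 T2 c c' : T1 <= T2 -> run T1 c c' -> run T2 c c'.
Proof. by move=> h h1 t b /h1[t1 ? ?]; exists t1 => //; lia. Qed.

Definition mbound (r : regs) : Prop := forall j, bitlen (r j) <= L.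

Definition locok (a : location) : bool :=
  match a with Dir j => bitlen j <= L | Ind j => bitlen j <= L end.

Definition opok (o : operand) : bool :=
  match o with Const z => bitlen z <= L | Loc a => locok a end.

Definition instrok (i : instr) : bool :=
  match i with
  | Op _ a x y => [&& locok a, opok x & opok y]
  | Inp a x => locok a && opok x
  | Jgtz x _ => opok x
  | Halt _ => true
  end.

(* Operands cost at most 3L each, and the destination at most 2L:
   (3L)^2 + 2L <= 11 L^2. *)
Definition K := 11 * L ^ 2.

Lemma op_cost_le r o : mbound r -> opok o -> op_cost r o <= 3 * L.
Proof.
move=> hr; case: o => [z /=|[j|j] /=] h; first lia.
  by have := hr j; lia.
by have := hr j; have := hr `|r j|; lia.
Qed.

Lemma loc_cost_le r a : mbound r -> locok a -> loc_cost r a <= 2 * L.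
Proof. by move=> hr; case: a => j /= h; have := hr j; lia. Qed.

Lemma L_gt0 r : mbound r -> 0 < L.
Proof. by move=> /(_ 0); apply: leq_trans. Qed.

(** The bound on the registers after the step is what limits the cost of [Inp]: the cell that was
    read is by then the content of a register. *)
Lemma step_cost_le r a i c : mbound r -> instrok i ->
  step w i (a, r) = inl c -> (forall r', c.2 = r' -> mbound r') ->
  step_cost w i (a, r) <= K.
Proof.
move=> hr; have L0 := L_gt0 hr; rewrite /K; case: i => //=.
- move=> f l x y /and3P[hl hx hy] _ _.
  have := op_cost_le hr hx; have := op_cost_le hr hy; have := loc_cost_le hr hl.
  by case: f => /=; nia.
- move=> l x /andP[hl hx] [<-] /(_ _ erefl (loc_index r l)) /=.
  rewrite /set_reg eqxx; have := op_cost_le hr hx; have := loc_cost_le hr hl; nia.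
- by move=> x l hx _ _; have := op_cost_le hr hx; nia.
Qed.

Lemma run_step i a r c : onth P a = Some i -> mbound r -> mbound c.2 ->
  instrok i -> step w i (a, r) = inl c -> run K (a, r) c.
Proof.
move=> ha hr hc hi hs t b h; exists (step_cost w i (a, r) + t).
  by apply: halts_step h.
by rewrite leq_add2r; apply: step_cost_le hs _ => // r' <-.
Qed.

Lemma mbound_set r a v : mbound r -> bitlen v <= L -> mbound (set_reg r a v).
Proof. by move=> hr hv j; rewrite /set_reg; case: ifP. Qed.

Variable L0 : nat.
Hypothesis L0_gt0 : 0 < L0.
Hypothesis inputs_le : forall i, bitlen (nth 0%R w i) <= L0.

(** There are two bounds: [L0] for the input and the cells of the store, and the larger [L] for all
    registers, including the temporaries that hold intermediate values. *)
Definition sbound (s : store) : Prop := forall j, bitlen (s j) <= L0.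

(** No operation does worse than adding the lengths of its operands, and everything read has length
    at most [L0]. *)
Lemma bitlen_evale s e : sbound s -> bitlen (evale w s e) <= esize e * L0.
Proof.
move=> hs; elim: e => [z|e _|e _|e _|f e1 IH1 e2 IH2] /=.
- by rewrite leq_pmulr.
- by apply: leq_trans (hs _) _; rewrite leq_pmull.
- by apply: leq_trans (inputs_le _) _; rewrite leq_pmull.
- by case: ifP => _; rewrite (_ : bitlen _ = 1) // mulSn; lia.
- apply: leq_trans (_ : bitlen (evale w s e1) + bitlen (evale w s e2) <= _).
    by case: f; rewrite ?bitlenD ?bitlenB ?bitlenM.
  by nia.
Qed.

Definition agrees (s : store) (r : regs) : Prop := forall j, r j.*2 = s j.

Lemma agrees_set_tmp s r t v : agrees s r -> agrees s (set_reg r (Dir (tmp t)) v).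
Proof. by move=> h j; rewrite /set_reg /= /tmp ifF ?h//; apply/eqP; lia. Qed.

Lemma set_regE r j v : set_reg r (Dir j) v j = v.
Proof. by rewrite /set_reg eqxx. Qed.

Lemma set_reg_tmp r t u v : u < t ->
  set_reg r (Dir (tmp t)) v (tmp u) = r (tmp u).
Proof. by move=> h; rewrite /set_reg /= ifF// /tmp; apply/eqP; lia. Qed.

Lemma ecodeP s e a t r : sbound s -> code_at P a (ecode a t e) ->
  agrees s r -> mbound r -> (t + esize e).*2.+2 <= L -> (esize e * L0).*2 <= L ->
  exists r', [/\ run (clen e * K) (a, r) (a + clen e, r'), agrees s r', mbound r',
    r' (tmp t) = evale w s e & forall u, u < t -> r' (tmp u) = r (tmp u)].
Proof.
move=> hs; elim: e a t r => [z|e IH|e IH|e IH|f e1 IH1 e2 IH2] a t r /= hc hr mr ht hL.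
all: try have z0 := bitlen_gt0 z.
all: have tL u : u <= t.+1 -> bitlen (tmp u) <= L
  by move=> hu; apply: leq_trans (bitlen_nat _) _; rewrite /tmp; lia.
all: have L1 : 0 < L by lia.
- case/code_at_cons: hc => hc _.
  have hz : bitlen z <= L by nia.
  exists (set_reg r (Dir (tmp t)) z); split.
  + rewrite mul1n; apply: run_step hc _ _ _ _ => //=.
    * exact: mbound_set.
    * by rewrite hz L1 !andbT tL.
    * by rewrite addrC add0r addn1.
  + exact: agrees_set_tmp.
  + exact: mbound_set.
  + exact: set_regE.
  + by move=> u; exact: set_reg_tmp.
- case/code_at_cat: hc => hc1; rewrite size_ecode => /code_at_cons[hc2 /code_at_cons[hc3 _]].
  have [||r1 [run1 hr1 mr1 e1 o1]] := IH _ _ _ hc1 hr mr; [lia|nia|].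
  pose v := evale w s e.
  have hv := bitlen_evale e hs; rewrite -/v in hv e1.
  have hvv : bitlen (v + v)%R <= L by apply: leq_trans (bitlenD _ _) _; nia.
  pose r2 := set_reg r1 (Dir (tmp t)) (v + v)%R.
  have mr2 : mbound r2 by exact: mbound_set.
  have hr2 : agrees s r2 by exact: agrees_set_tmp.
  have er2 : r2 (tmp t) = (v + v)%R by exact: set_regE.
  (* Doubling commutes with the absolute value, so the register addressed by v + v is that of cell
     |v|, whatever the sign of v. *)
  have er3 : r2 `|r2 (tmp t)| = s `|v|.
    by rewrite er2 -hr2; congr (r2 _); lia.
  have hsv : bitlen (s `|v|) <= L by apply: leq_trans (hs _) _; nia.
  exists (set_reg r2 (Dir (tmp t)) (s `|v|)); split.
  + rewrite -addn2 mulnDl; apply: run_trans run1 _.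
    rewrite ssrnat.mul2n -addnn; apply: (@run_trans _ _ _ ((a + clen e).+1, r2)).
      apply: run_step hc2 _ _ _ _ => //=; first by rewrite tL.
      by rewrite e1.
    apply: run_step hc3 _ _ _ _ => //=.
    * exact: mbound_set.
    * by rewrite tL.
    * by rewrite er3 addrC add0r; congr (inl (_, _)); lia.
  + exact: agrees_set_tmp.
  + exact: mbound_set.
  + exact: set_regE.
  + by move=> u hu; rewrite set_reg_tmp// /r2 set_reg_tmp// o1.
- case/code_at_cat: hc => hc1; rewrite size_ecode => /code_at_cons[hc2 _].
  have [||r1 [run1 hr1 mr1 e1 o1]] := IH _ _ _ hc1 hr mr; [lia|nia|].
  have hin : bitlen (nth 0%R w `|evale w s e|) <= L.
    by apply: leq_trans (inputs_le _) _; nia.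
  exists (set_reg r1 (Dir (tmp t)) (nth 0%R w `|evale w s e|)); split.
  + rewrite -addn1 mulnDl mul1n; apply: run_trans run1 _.
    apply: run_step hc2 _ _ _ _ => //=.
    * exact: mbound_set.
    * by rewrite tL.
    * by rewrite /input_value /= e1; congr (inl (_, _)); lia.
  + exact: agrees_set_tmp.
  + exact: mbound_set.
  + exact: set_regE.
  + by move=> u hu; rewrite set_reg_tmp// o1.
- case/code_at_cat: hc => hc1; rewrite size_ecode.
  move=> /code_at_cons[hc2 /code_at_cons[hc3 /code_at_cons[hc4 /code_at_cons[hc5 _]]]].
  have [||r1 [run1 hr1 mr1 e1 o1]] := IH _ _ _ hc1 hr mr; [lia|nia|].
  have mr2 z : z = 0%R \/ z = 1%R -> mbound (set_reg r1 (Dir (tmp t)) z).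
    by move=> hz; apply: mbound_set => //; case: hz => ->.
  exists (set_reg r1 (Dir (tmp t)) (if (0 < evale w s e)%R then 1%R else 0%R)); split.
  + rewrite -addn4 mulnDl; apply: run_trans run1 _.
    have [pos|npos] := boolP (0 < evale w s e)%R.
      apply: (@run_le (K + K)); first by lia.
      apply: (@run_trans _ _ _ ((a + clen e).+3, r1)).
        apply: run_step hc2 _ _ _ _ => //=; first by rewrite tL.
        by rewrite e1 pos.
      apply: run_step hc5 _ _ _ _ => //=.
      * by apply: mr2; right.
      * by rewrite tL// L1.
      * by congr (inl (_, _)); lia.
    apply: (@run_le (K + (K + K))); first by lia.
    apply: (@run_trans _ _ _ ((a + clen e).+1, r1)).
      apply: run_step hc2 _ _ _ _ => //=; first by rewrite tL.
      by rewrite e1 (negbTE npos).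
    apply: (@run_trans _ _ _ ((a + clen e).+2, set_reg r1 (Dir (tmp t)) 0%R)).
      apply: run_step hc3 _ _ _ _ => //=.
      * by apply: mr2; left.
      * by rewrite tL// L1.
    apply: run_step hc4 _ _ _ _ => //=.
    * by apply: mr2; left.
    * by apply: mr2; left.
    * by congr (inl (_, _)); lia.
  + exact: agrees_set_tmp.
  + by apply: mr2; case: ifP => _; [right|left].
  + exact: set_regE.
  + by move=> u hu; rewrite set_reg_tmp// o1.
- case/code_at_cat: hc => hc1; rewrite size_ecode => /code_at_cat[hc2].
  rewrite size_ecode => /code_at_cons[hc3 _].
  have [||r1 [run1 hr1 mr1 v1 o1]] := IH1 _ _ _ hc1 hr mr; [lia|nia|].
  have [||r2 [run2 hr2 mr2 v2 o2]] := IH2 _ _ _ hc2 hr1 mr1; [lia|nia|].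
  have hv : bitlen (arith_value f (evale w s e1) (evale w s e2)) <= L.
    by have := bitlen_evale (Bin f e1 e2) hs => /=; lia.
  exists (set_reg r2 (Dir (tmp t)) (arith_value f (evale w s e1) (evale w s e2))); split.
  + rewrite (_ : _ * K = clen e1 * K + (clen e2 * K + K)); last by rewrite mulSn; lia.
    apply: run_trans run1 _; apply: run_trans run2 _.
    apply: run_step hc3 _ _ _ _ => //=.
    * exact: mbound_set.
    * by rewrite !tL.
    * by rewrite v2 o2// v1; congr (inl (_, _)); lia.
  + exact: agrees_set_tmp.
  + exact: mbound_set.
  + exact: set_regE.
  + by move=> u hu; rewrite set_reg_tmp// o2 ?o1//; lia.
Qed.


(** A step of [exec] stands for at most [M] machine instructions, each of cost at most [K]. The
    induction is on the execution, not on the statement, because of the loops. *)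
Lemma scodeP M c s k s' a r : (M * L0).*2 <= L -> M.*2 <= L -> ssize c <= M ->
  exec w L0 c s k s' -> sbound s -> code_at P a (scode a c) -> agrees s r ->
  mbound r ->
  exists r', [/\ run (k * (M * K)) (a, r) (a + slen c, r'), agrees s' r',
    mbound r' & sbound s'].
Proof.
move=> hM hM2 + he; elim: {c s k s'} he a r.
- move=> s e1 e2 hb a r /= hm hs hc hr mr.
  case/code_at_cat: hc => hc1; rewrite size_ecode => /code_at_cat[hc2].
  rewrite size_ecode => /code_at_cons[hc3 /code_at_cons[hc4 _]].
  have [||r1 [run1 hr1 mr1 v1 o1]] := ecodeP hs hc1 hr mr; [lia|nia|].
  have [||r2 [run2 hr2 mr2 v2 o2]] := ecodeP hs hc2 hr1 mr1; [lia|nia|].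
  have := bitlen_evale e1 hs; move: v1 v2.
  set x1 := evale w s e1; set x2 := evale w s e2 => v1 v2 hx1.
  have hvv : bitlen (x1 + x1)%R <= L by apply: leq_trans (bitlenD _ _) _; nia.
  pose r3 := set_reg r2 (Dir (tmp 0)) (x1 + x1)%R.
  have mr3 : mbound r3 by exact: mbound_set.
  have hr3 : agrees s r3 by exact: agrees_set_tmp.
  have er3 : r3 (tmp 0) = (x1 + x1)%R by exact: set_regE.
  have er3' : r3 (tmp 1) = x2 by [].
  have tL u : u <= 1 -> bitlen (tmp u) <= L.
    by move=> hu; apply: leq_trans (bitlen_nat _) _; rewrite /tmp; lia.
  have hx2 : bitlen x2 <= L by apply: leq_trans hb _; nia.
  exists (set_reg r3 (Ind (tmp 0)) x2); split.
  + apply: (@run_le (clen e1 * K + (clen e2 * K + (K + K)))).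
      have := clen_esize e1; have := clen_esize e2; nia.
    apply: run_trans run1 _; apply: run_trans run2 _.
    apply: (@run_trans _ _ _ ((a + clen e1 + clen e2).+1, r3)).
      apply: run_step hc3 _ _ _ _ => //=; first by rewrite tL.
      by rewrite o2// v1.
    apply: run_step hc4 _ _ _ _ => //=.
    * exact: mbound_set.
    * by rewrite !tL//; lia.
    * by rewrite addr0 er3'; congr (inl (_, _)); lia.
  + move=> j; rewrite /set_reg /upd /= er3 hr3; congr (if _ then _ else _).
    by apply/eqP/eqP; lia.
  + exact: mbound_set.
  + by move=> j; rewrite /upd; case: ifP.
- move=> s s1 s2 c1 c2 k1 k2 _ IH1 _ IH2 a r /= hm hs /code_at_cat[hc1].
  rewrite size_scode => hc2 hr mr.
  have [|r1 [run1 hr1 mr1 hs1]] := IH1 _ _ _ hs hc1 hr mr; first lia.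
  have [|r2 [run2 hr2 mr2 hs2]] := IH2 _ _ _ hs1 hc2 hr1 mr1; first lia.
  by exists r2; split => //; rewrite mulnDl addnA; apply: run_trans run1 run2.
- move=> s e c npos a r /= hm hs /code_at_cat[hc1]; rewrite size_ecode.
  move=> /code_at_cons[hc2 /code_at_cons[hc3 _]] hr mr.
  have [||r1 [run1 hr1 mr1 v1 o1]] := ecodeP hs hc1 hr mr; [lia|nia|].
  have tL : bitlen (tmp 0) <= L by apply: leq_trans (bitlen_nat _) _; rewrite /tmp; lia.
  exists r1; split => //; apply: (@run_le (clen e * K + (K + K))).
    rewrite mul1n addnn -ssrnat.mul2n -mulnDl leq_mul2r; have := clen_esize e; lia.
  apply: run_trans run1 _; apply: (@run_trans _ _ _ ((a + clen e).+1, r1)).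
    by apply: run_step hc2 _ _ _ _ => //=; rewrite v1 (negbTE npos).
  apply: run_step hc3 _ _ _ _ => //=.
  by congr (inl (_, _)); lia.
- move=> s s1 s2 e c k1 k2 pos _ IH1 _ IH2 a r /= hm hs hc hr mr.
  case/code_at_cat: (hc) => hc1; rewrite size_ecode.
  move=> /code_at_cons[hc2 /code_at_cons[_ /code_at_cat[hc3]]].
  rewrite size_scode => /code_at_cons[hc4 _].
  have [||r1 [run1 hr1 mr1 v1 o1]] := ecodeP hs hc1 hr mr; [lia|nia|].
  have tL : bitlen (tmp 0) <= L by apply: leq_trans (bitlen_nat _) _; rewrite /tmp; lia.
  have [|r2 [run2 hr2 mr2 hs2]] := IH1 _ _ _ hs hc3 hr1 mr1; first lia.
  have [r3 [run3 hr3 mr3 hs3]] := IH2 _ _ hm hs2 hc hr2 mr2.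
  exists r3; split => //.
  apply: (@run_le (clen e * K + (K + (k1 * (M * K) + (K + k2 * (M * K)))))).
    have : (clen e).+2 * K <= M * K.
      by rewrite leq_mul2r; have := clen_esize e; lia.
    by rewrite [(_ + k2).+1 * _]mulSn mulnDl 2!mulSn; lia.
  apply: run_trans run1 _; apply: (@run_trans _ _ _ ((a + clen e).+2, r1)).
    by apply: run_step hc2 _ _ _ _ => //=; rewrite v1 pos.
  apply: run_trans run2 _; apply: run_trans run3.
  by apply: run_step hc4 _ _ _ _ => //=.
Qed.

End simulation.

Definition compile (c : stmt) : program :=
  scode 0 c ++
  [:: Jgtz (Loc (Dir 0)) (slen c).+2; Halt false; Halt true].

Lemma compileP (c : stmt) : exists A : nat, forall w L s k,
  0 < L -> (forall i, bitlen (nth 0%R w i) <= L) ->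
  exec w L c (fun=> 0%R) k s ->
  exists2 t, halts (compile c) w init_config t (0 < s 0)%R & t <= A * k.+1 * L ^ 2.
Proof.
pose M := (ssize c).+1.
(* With L = 2 M L0, each of the k steps takes at most M instructions of cost 11 L^2 = 44 M^2 L0^2;
   the second term covers the final jump and halt. *)
exists (44 * M ^ 3 + 100 * M ^ 2) => w L0 s k hL0 hw hx.
pose L := (M * L0).*2.
have hs0 : sbound L0 (fun=> 0%R) by move=> j.
have hM2 : M.*2 <= L by rewrite /L; nia.
have hL : 0 < L by rewrite (leq_trans _ hM2).
have hM : ssize c <= M by rewrite /M.
have hc : code_at (compile c) 0 (scode 0 c).
  by exists [::], [:: Jgtz (Loc (Dir 0)) (slen c).+2; Halt false; Halt true].
have hr0 : agrees (fun=> 0%R) (fun=> 0%R) by [].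
have mr0 : mbound L (fun=> 0%R) by move=> j.
have [r [hrun hr mr _]] := scodeP hL0 hw (leqnn _) hM2 hM hx hs0 hc hr0 mr0.
have nthP i : onth (compile c) (slen c + i) =
    onth [:: Jgtz (Loc (Dir 0)) (slen c).+2; Halt false; Halt true] i.
  rewrite /compile -(size_scode c 0).
  by move: (scode 0 c) [:: _; _; _] => l1 l2; elim: l1.
have := nthP 0; rewrite addn0 => h0.
have := nthP 1; rewrite addn1 => h1.
have := nthP 2; rewrite addn2 => h2.
rewrite add0n in hrun.
have r0 : r 0 = s 0 by rewrite -hr.
have [t ht le] : exists2 t, halts (compile c) w (slen c, r) t (0 < s 0)%R & t <= (K L).+1.
  have cost : step_cost w (Jgtz (Loc (Dir 0)) (slen c).+2) (slen c, r) <= K L.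
    apply: leq_trans (op_cost_le mr _) _ => //=; rewrite /K; nia.
  exists (step_cost w (Jgtz (Loc (Dir 0)) (slen c).+2) (slen c, r) + 1); last lia.
  apply: (@halts_step _ _ (slen c, r) _ _ _ _ h0 erefl); rewrite /= r0.
  case: ifP => _; [apply: (@halts_now _ _ (_, _) _ _ h2) => //|].
  exact: (@halts_now _ _ (_, _) _ _ h1).
have [t' ht' le'] := hrun _ _ ht; exists t' => //.
apply: leq_trans le' _; rewrite /K in le *; rewrite /L in le *.
have sqL : (M * L0).*2 ^ 2 = 4 * (M ^ 2 * L0 ^ 2) by rewrite -ssrnat.mul2n !expnMn.
rewrite sqL in le *.
have : 0 < L0 ^ 2 by rewrite expn_gt0 hL0.
have : 0 < M ^ 2 by rewrite expn_gt0.
rewrite [M ^ 3]expnS.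
move: (M ^ 2) (L0 ^ 2) le => m l le m0 l0.
apply: leq_trans (leq_add (leqnn _) le) _.
have h3 : 0 < m * l by rewrite muln_gt0 m0.
rewrite (_ : _ * k.+1 * l = 44 * k * M * (m * l) + 44 * M * (m * l) + 100 * k.+1 * (m * l)).
  rewrite (_ : k * (M * (11 * (4 * (m * l)))) = 44 * k * M * (m * l)); last by lia.
  by move: (m * l) h3 => x; nia.
lia.
Qed.

Local Open Scope ring_scope.

(** * Sturm sequences as arithmetic expressions *)

Definition eadd := Bin AddOp.
Definition esub := Bin SubOp.
Definition emul := Bin MulOp.
Definition esg (e : expr) : expr := esub (IsPos e) (IsPos (esub (Cst 0) e)).
Definition eeq (e1 e2 : expr) : expr :=
  esub (esub (Cst 1) (IsPos (esub e1 e2))) (IsPos (esub e2 e1)).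
(** Both branches are always evaluated; this is harmless, since every expression has a value. *)
Definition eite (c e1 e2 : expr) : expr :=
  eadd (emul c e1) (emul (esub (Cst 1) c) e2).
Definition eprod (es : seq expr) : expr := foldr emul (Cst 1) es.
Definition esum (es : seq expr) : expr := foldr eadd (Cst 0) es.

Lemma evale_esg w s e : evale w s (esg e) = sgz (evale w s e).
Proof. by rewrite /= sub0r oppr_gt0; case: sgzP. Qed.

Lemma evale_eeq w s e1 e2 :
  evale w s (eeq e1 e2) = (evale w s e1 == evale w s e2)%:R.
Proof. by rewrite /= !subr_gt0; case: ltgtP. Qed.

Lemma evale_eite w s c e1 e2 (b : bool) : evale w s c = b%:R ->
  evale w s (eite c e1 e2) = if b then evale w s e1 else evale w s e2.
Proof. by move=> /= ->; case: b; rewrite ?subrr ?subr0 ?mul1r ?mul0r ?addr0 ?add0r. Qed.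

Lemma evale_eprod w s es : evale w s (eprod es) = \prod_(e <- es) evale w s e.
Proof. by elim: es => [|e es IH]; rewrite ?big_nil// big_cons -IH. Qed.

Lemma evale_esum w s es : evale w s (esum es) = \sum_(e <- es) evale w s e.
Proof. by elim: es => [|e es IH]; rewrite ?big_nil// big_cons -IH. Qed.

Section sturm.
Variable R : rcfType.

Lemma cindexRZl (c : R) (q p : {poly R}) : 0 < c ->
  cindexR (c *: q) p = cindexR q p.
Proof.
move=> c0; rewrite /cindexR; apply: eq_bigr => x _.
by rewrite jump_mulCp gtr0_sgz// mul1r.
Qed.

(** Both numerators are even powers of the leading coefficient times -(p %% q), and the Cauchy index
    ignores positive factors of the numerator. Hence any exponent [N] can replace the one that
    pseudo-division chooses depending on p and q. *)
Lemma cindexR_prem (p q m r : {poly R}) (N : nat) : q != 0 ->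
  lead_coef q ^+ N *: p = m * q + r -> (size r < size q)%N ->
  cindexR (next_mod p q) q = cindexR (- (lead_coef q ^+ N *: r)) q.
Proof.
move=> q0 e hr; set l := lead_coef q in e *.
have l0 : l != 0 by rewrite lead_coef_eq0.
have -> : r = l ^+ N *: (p %% q) by rewrite (modpP e hr) modpZl.
have -> : next_mod p q = l ^+ Pdiv.Ring.rscalp p q ^+ 2 *: - (p %% q).
  rewrite /next_mod modpE -/l; set c := l ^+ _.
  have c0 : c != 0 by rewrite expf_neq0.
  by rewrite scalerN scalerA expr2 mulfK// scaleNr.
rewrite scalerA -expr2 -scalerN !cindexRZl//.
all: by rewrite -exprM mulnC exprM exprn_gt0// exprn_even_gt0.
Qed.

(** [m] is only a formal size: the coefficients are known when the expressions are evaluated, and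
    the top ones may turn out to be 0. *)
Definition pv (w : seq int) (s : store) (m : nat) (E : nat -> expr) : {poly R} :=
  \poly_(i < m) (evale w s (E i))%:~R.

Lemma pvS0 w s m E : evale w s (E m) = 0 -> pv w s m.+1 E = pv w s m E.
Proof.
move=> h; apply/polyP => i; rewrite !coef_poly ltnS leq_eqVlt.
by case: eqVneq => [->|]//=; rewrite h ltnn.
Qed.

Lemma size_pvS w s m E : evale w s (E m) != 0 -> size (pv w s m.+1 E) = m.+1.
Proof. by move=> h; rewrite size_poly_eq// intr_eq0. Qed.

Lemma lead_pvS w s m E : evale w s (E m) != 0 ->
  lead_coef (pv w s m.+1 E) = (evale w s (E m))%:~R.
Proof. by move=> h; rewrite lead_coefE size_pvS//= coef_poly ltnSn. Qed.

(** If both top coefficients are nonzero, the product has degree m + l. Its signs at -oo and +oo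
    differ iff m + l is odd, and then the sign at +oo is that of the product of the top
    coefficients. If the coefficient [E m] is 0, the formal size drops. *)
Lemma expr_crossR m E l F : exists e, forall w s, evale w s (F l) != 0 ->
  evale w s e = crossR (pv w s m E * pv w s l.+1 F).
Proof.
elim: m => [|m [e0 IH]].
  by exists (Cst 0) => w s _; rewrite /pv poly_def big_ord0 mul0r crossR0.
pose e1 := if odd (m + l) then esg (emul (E m) (F l)) else Cst 0.
exists (eite (eeq (E m) (Cst 0)) e0 e1) => w s hl.
rewrite (evale_eite _ _ (evale_eeq _ _ _ _)) /=; case: eqVneq => [z|hm].
  by rewrite IH// (pvS0 z).
have -> : evale w s e1 = if odd (m + l) then sgz (evale w s (E m) * evale w s (F l)) else 0.
  by rewrite /e1; case: odd => //; rewrite evale_esg.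
set p := pv _ _ _ _; set q := pv _ _ _ _.
have p0 : p != 0 by rewrite -size_poly_gt0 size_pvS.
have q0 : q != 0 by rewrite -size_poly_gt0 size_pvS.
rewrite /crossR /variation /sgp_minfty /sgp_pinfty size_mul// lead_coefM.
rewrite !lead_pvS// !size_pvS// addSn addnS /=.
move: (evale w s _) (evale w s _) hm hl => a b a0 b0.
have ab0 : a * b != 0 by rewrite mulf_neq0.
rewrite -intrM -signr_odd; case: odd => /=.
  rewrite expr1 mulN1r sgrN mulNr -expr2 oppr_lt0 exprn_even_gt0//=.
  by rewrite sgr_eq0 intr_eq0 [b * a]mulrC ab0 mulr1 sgz_sgr sgz_int.
by rewrite expr0 mul1r -expr2 ltNge sqr_ge0 mulr0.
Qed.

(* Multiplying by the leading coefficient of the divisor at every step, even if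
   the leading coefficient of the dividend vanishes, makes the number of steps
   depend on m and l only. *)
Lemma expr_prem l F m E : exists N E', forall w s, exists h,
  (evale w s (F l))%:~R ^+ N *: pv w s m E = h * pv w s l.+1 F + pv w s l E'.
Proof.
elim: m E => [|m IH] E.
  exists 0%N, (fun=> Cst 0) => w s; exists 0; rewrite mul0r add0r expr0 scale1r.
  by apply/polyP => i; rewrite !coef_poly if_same.
have [lm|ml] := leqP l m; last first.
  exists 0%N, (fun i => if (i < m.+1)%N then E i else Cst 0) => w s; exists 0.
  rewrite mul0r add0r expr0 scale1r; apply/polyP => i; rewrite !coef_poly.
  case: (ltnP i m.+1) => hi; last by rewrite if_same.
  by rewrite (leq_trans hi).
(* These are the coefficients of F_l p - E_m X^(m-l) q, in which the term of degree m cancels. *)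
have [N [E' IH']] := IH (fun i => esub (emul (F l) (E i))
  (emul (E m) (if (i < m - l)%N then Cst 0 else F (i - (m - l))%N))).
exists N.+1, E' => w s; have [h eh] := IH' w s.
exists ((evale w s (F l))%:~R ^+ N *: ((evale w s (E m))%:~R *: 'X^(m - l)) + h).
rewrite mulrDl -addrA -eh exprS mulrC -scalerA -scalerAl -scalerDr; congr (_ *: _).
apply/polyP => i; rewrite coefD -scalerAl !coefZ coefXnM !coef_poly /= ltnS.
have [lt|gt|->] := ltngtP i m => /=; rewrite -?lt0n.
- rewrite intrB !intrM; case: ltnP => hi; rewrite ?mulr0 ?subr0 ?add0r//.
  rewrite ltnS (_ : (i - (m - l) <= l)%N); last lia.
  by ring.
- case: ltnP => hi; first by lia.
  by rewrite ltnS ifF ?mulr0 ?addr0//; apply/negbTE; lia.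
- rewrite ltnNge leq_subr /= subKn// ltnSn addr0 mulrC; ring.
Qed.

(** Unfolds the Euclidean recursion for the Cauchy index. In either case, vanishing top coefficient
    or division, the formal size of the numerator decreases, so the depth depends on [l] only. *)
Lemma expr_cindexR l F m E : exists e, forall w s,
  evale w s e = cindexR (pv w s l F) (pv w s m E).
Proof.
elim: l F m E => [|l IH] F m E.
  by exists (Cst 0) => w s; rewrite {1}/pv poly_def big_ord0 cindexR0p.
have [e0 he0] := IH F m E; have [e1 he1] := expr_crossR m E l F.
have [N [E' hE']] := expr_prem l F m E.
pose G i := esub (Cst 0) (emul (eprod (nseq N (F l))) (E' i)).
have [e2 he2] := IH G l.+1 F.
exists (eite (eeq (F l) (Cst 0)) e0 (eadd e1 e2)) => w s.
rewrite (evale_eite _ _ (evale_eeq _ _ _ _)) /=; case: eqVneq => [z|hl].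
  by rewrite he0 (pvS0 z).
have [h eh] := hE' w s.
have q0 : pv w s l.+1 F != 0 by rewrite -size_poly_gt0 size_pvS.
have eh' := eh; rewrite -lead_pvS// in eh'.
rewrite he1// cindexR_rec (cindexR_prem q0 eh') ?size_pvS ?ltnS ?size_poly// he2.
congr (_ + cindexR _ _); apply/polyP => i.
rewrite coefN coefZ !coef_poly lead_pvS//; case: ifP; last by rewrite mulr0 oppr0.
rewrite /G /= evale_eprod big_nseq -Monoid.iteropE sub0r rmorphN rmorphM /=.
by rewrite -[iterop _ _ _ _]/(_ ^+ N) rmorphXn.
Qed.

(** By Sturm's theorem the Cauchy index of p'/p is the number of distinct real roots of p. *)
Lemma expr_noroot m E : exists e, forall w s, pv w s m E != 0 ->
  evale w s e = (`[< forall t, (pv w s m E).[t] != 0 >])%:R.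
Proof.
pose F i := emul (Cst i.+1) (E i.+1).
have [e he] := expr_cindexR m.-1 F m E.
exists (esub (Cst 1) (IsPos e)) => w s p0 /=; rewrite he.
have -> : pv w s m.-1 F = (pv w s m E)^`() * 1.
  rewrite mulr1; apply/polyP => i; rewrite coef_deriv !coef_poly.
  rewrite (_ : (i < m.-1)%N = (i.+1 < m)%N); last lia.
  case: ifP => _; last by rewrite mul0rn.
  by rewrite /F /= intrM mulr_natl.
have <- : taq (rootsR (pv w s m E)) 1 = cindexR ((pv w s m E)^`() * 1) (pv w s m E).
  by rewrite /rootsR taq_cindex.
rewrite /taq (eq_bigr (fun=> 1)); last by move=> x _; rewrite hornerC sgz1.
have rP x : (x \in rootsR (pv w s m E)) = root (pv w s m E) x.
  by rewrite -(roots_on_rootsR p0) in_itv /=.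
rewrite big_const_seq count_predT iter_addr_0.
case: (rootsR _) rP => [|x r] rP /=.
  rewrite asboolT// => t; apply/negP => /eqP/rootP; by rewrite -rP.
rewrite asboolF => [|/(_ x)/negP]; first by rewrite mulrn_wgt0// subrr.
by apply; rewrite -/(root _ _) -rP mem_head.
Qed.

End sturm.

Local Open Scope ring_scope.

(** * Multivariate polynomials on lines *)

Lemma mpoly_ring_ind (n : nat) (R : comNzRingType) (Q : mpoly n R -> Prop) :
  (forall c, Q (mpolyC n c)) -> (forall i, Q (mpolyX R (mnm1 i))) ->
  (forall p q, Q p -> Q q -> Q (p + q)) -> (forall p q, Q p -> Q q -> Q (p * q)) ->
  forall p, Q p.
Proof.
move=> hC hX hD hM p; elim/mpolyind: p => [|c m p _ _ hp]; first exact: (hC 0).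
apply: (hD) => //; rewrite -mul_mpolyC; apply: (hM) => //; rewrite mpolyXE_id.
elim/big_ind: _ => [||i _]; [exact: (hC 1)|exact: hM|].
by elim: (m i) => [|k IH]; [exact: (hC 1)|rewrite exprS; exact: hM].
Qed.

Section lines.
Variables (R : rcfType) (n : nat).
Implicit Types (P : mpoly n R) (x v : 'I_n -> R).

(** The restriction t |-> P(x + t v), kept as a univariate polynomial so that its degree, derivative
    and real roots are available. *)
Definition line P x v : {poly R} := mmap polyC (fun i => (x i)%:P + v i *: 'X) P.

Lemma line_horner P x v t : (line P x v).[t] = meval (fun i => x i + t * v i) P.
Proof.
rewrite /line; elim/mpoly_ring_ind: P => [c|i|p q IHp IHq|p q IHp IHq].
- by rewrite mmapC mevalC hornerC.
- by rewrite mmapX mmap1U mevalXU hornerD hornerC hornerZ hornerX mulrC.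
- by rewrite rmorphD mevalD hornerD IHp IHq.
- by rewrite rmorphM mevalM hornerM IHp IHq.
Qed.

Lemma line_deriv P x v :
  (line P x v)^`() = \sum_i v i *: line (mderiv i P) x v.
Proof.
rewrite /line; elim/mpoly_ring_ind: P => [c|i|p q IHp IHq|p q IHp IHq].
- by rewrite mmapC derivC big1// => i _; rewrite mderivC raddf0 scaler0.
- rewrite mmapX mmap1U derivD derivC add0r derivZ derivX (bigD1 i)//= big1.
    rewrite mderivX mnm1E eqxx scale1r addr0 (_ : mnm_sub _ _ = mnm0).
      by rewrite mpolyX0 rmorph1.
    by apply/mnmP => j; rewrite mnmE subnn mnmE.
  by move=> j ji; rewrite mderivX mnm1E eq_sym (negbTE ji) scale0r raddf0 scaler0.
- rewrite rmorphD derivD IHp IHq -big_split; apply: eq_bigr => i _ /=.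
  by rewrite mderivD rmorphD scalerDr.
- rewrite rmorphM derivM IHp IHq big_distrl big_distrr -big_split.
  apply: eq_bigr => i _ /=.
  by rewrite mderivM rmorphD/= !rmorphM/= scalerDr -scalerAl -scalerAr.
Qed.

Lemma lineE P x v : line P x v =
  \sum_(m <- msupp P) mcoeff m P *: \prod_i ((x i)%:P + v i *: 'X) ^+ m i.
Proof.
by apply: eq_bigr => m _; rewrite mul_polyC.
Qed.

(** Some v i may be 0, so the true degree can be smaller; the coefficient at the formal degree is
    multiplicative all the same. *)
Lemma prod_coefs (r : seq 'I_n) x v (m : 'I_n -> nat) :
  let p := \prod_(i <- r) ((x i)%:P + v i *: 'X) ^+ m i in
  (size p <= (\sum_(i <- r) m i).+1)%N /\
  p`_(\sum_(i <- r) m i) = \prod_(i <- r) v i ^+ m i.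
Proof.
have mulc (p q : {poly R}) a b : (size p <= a.+1)%N -> (size q <= b.+1)%N ->
    (size (p * q)%R <= (a + b).+1)%N /\ (p * q)`_(a + b) = p`_a * q`_b.
  move=> hp hq; split.
    by apply: leq_trans (size_polyMleq _ _) _; lia.
  have ha : (a < (a + b).+1)%N by lia.
  rewrite coefM (bigD1 (Ordinal ha))//= addKn big1 ?addr0// => -[i /= hi].
  rewrite -val_eqE /= => ne; have [ia|ia] := ltnP i a.
    by rewrite [q`_ _]nth_default ?mulr0// (leq_trans hq)//; lia.
  by rewrite nth_default ?mul0r// (leq_trans hp)//; move: ne; lia.
have lin i : (size ((x i)%:P + v i *: 'X)%R <= 2)%N.
  apply: leq_trans (size_polyD _ _) _; rewrite geq_max (leq_trans (size_polyC_leq1 _))//=.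
  by apply: leq_trans (size_scale_leq _ _) _; rewrite size_polyX.
have powc i k : (size (((x i)%:P + v i *: 'X) ^+ k)%R <= k.+1)%N /\
    (((x i)%:P + v i *: 'X) ^+ k)`_k = v i ^+ k.
  elim: k => [|k [IH1 IH2]]; first by rewrite !expr0 size_poly1 coef1.
  rewrite !exprS; have [h1 h2] := mulc _ _ 1%N k (lin i) IH1.
  by split => //; rewrite h2 IH2 coefD coefC coefZ coefX /= add0r mulr1.
elim: r => [|i r [IH1 IH2]] /=; first by rewrite !big_nil size_poly1 coef1.
rewrite !big_cons; have [p1 p2] := powc i (m i).
by have [h1 h2] := mulc _ _ _ _ p1 IH1; split => //; rewrite h2 p2 IH2.
Qed.

Definition topP d P : mpoly n R :=
  \sum_(m <- msupp P | mdeg m == d) mcoeff m P *: mpolyX R m.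

Lemma size_line d P x v : (mpoly.msize P <= d.+1)%N -> (size (line P x v) <= d.+1)%N.
Proof.
move=> hP; rewrite lineE big_seq.
elim/big_ind: _ => [|p q hp hq|m mP]; first by rewrite size_poly0.
  by apply: leq_trans (size_polyD _ _) _; rewrite geq_max hp.
apply: leq_trans (size_scale_leq _ _) _.
have [h _] := prod_coefs (index_enum _) x v m; apply: leq_trans h _.
by rewrite -mdegE (leq_trans _ hP)// msize_mdeg_lt.
Qed.

Lemma coef_line d P x v : (mpoly.msize P <= d.+1)%N ->
  (line P x v)`_d = meval v (topP d P).
Proof.
move=> hP; rewrite lineE coef_sum /topP raddf_sum [RHS]big_mkcond /=.
rewrite !big_seq; apply: eq_bigr => m mP.
rewrite coefZ mevalZ mevalX.
have [h1 h2] := prod_coefs (index_enum _) x v m; rewrite -mdegE in h1 h2.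
case: eqVneq => [<-|ne]; first by rewrite h2.
rewrite nth_default ?mulr0// (leq_trans h1)//.
by have := leq_trans (msize_mdeg_lt mP) hP; rewrite ltnS leq_eqVlt (negbTE ne).
Qed.

Lemma msize_topP d P : (mpoly.msize (topP d P) <= d.+1)%N.
Proof.
rewrite /topP; elim/big_ind: _ => [|p q hp hq|m /eqP md]; first by rewrite msize0.
  by apply: leq_trans (msizeD_le _ _) _; rewrite geq_max hp.
by apply: leq_trans (msizeZ_le _ _) _; rewrite msizeX md.
Qed.

Lemma mcoeff_topP d P m : mdeg m = d -> mcoeff m (topP d P) = mcoeff m P.
Proof.
move=> md; rewrite /topP raddf_sum /= [in RHS](mpolyE P) raddf_sum big_mkcond /=.
apply: eq_bigr => k _; rewrite mcoeffZ mcoeffX; case: eqVneq => // ne.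
by case: eqVneq => [e|]; rewrite ?mulr0//; rewrite e md eqxx in ne.
Qed.

Lemma topP_idem d P v : meval v (topP d (topP d P)) = meval v (topP d P).
Proof.
congr meval; apply/mpolyP => m; have [md|md] := eqVneq (mdeg m) d.
  by rewrite mcoeff_topP.
have z Q : mcoeff m (topP d Q) = 0.
  rewrite /topP raddf_sum big1//= => k /eqP kd; rewrite mcoeffZ mcoeffX.
  by case: (eqVneq k m) md => [<-|]; rewrite ?kd ?eqxx ?mulr0.
by rewrite !z.
Qed.

Lemma topPN d P v : odd d -> meval (fun i => - v i) (topP d P) = - meval v (topP d P).
Proof.
move=> od; rewrite /topP raddf_sum [meval v _]raddf_sum -sumrN /=; apply: eq_bigr => m /eqP md.
rewrite !mevalZ !mevalX -mulrN; congr (_ * _).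
rewrite (eq_bigr (fun i => (-1) ^+ m i * v i ^+ m i)); last first.
  by move=> i _; rewrite -exprMn mulN1r.
by rewrite big_split /= -expr_sum -mdegE md -signr_odd od expr1 mulN1r.
Qed.

Lemma poly_root_inj (p : {poly R}) (f : nat -> R) : injective f ->
  (forall i, p.[f i] = 0) -> p = 0.
Proof.
move=> fi hp; apply: (@poly_ltsp_roots _ _ (mkseq f (size p))).
- by rewrite size_mkseq.
- by rewrite mkseq_uniq.
- by apply/allP => _ /mapP[i _ ->]; apply/rootP.
Qed.

Lemma digits_inj (N k : nat) (a b : 'I_k -> nat) :
  (forall i, a i < N)%N -> (forall i, b i < N)%N ->
  (\sum_i a i * N ^ i = \sum_i b i * N ^ i)%N -> a =1 b.
Proof.
elim: k a b => [|k IH] a b ha hb; first by move=> _ [].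
have N0 : (0 < N)%N by apply: leq_ltn_trans (ha ord0).
have e (c : 'I_k.+1 -> nat) : (\sum_i c i * N ^ i =
    (\sum_(i < k) c (lift ord0 i) * N ^ i) * N + c ord0)%N.
  rewrite big_ord_recl muln1 addnC big_distrl; congr (_ + _)%N.
  by apply: eq_bigr => i _; rewrite lift0 expnSr mulnA.
rewrite !e => h i; have h0 : a ord0 = b ord0.
  by have := congr1 (modn^~ N) h; rewrite !modnMDl !modn_small.
have [j ->|->//] := unliftP ord0 i.
apply: (IH (a \o lift ord0) (b \o lift ord0)) => //=.
by apply/eqP; rewrite -(eqn_pmul2r N0) -(eqn_add2r (a ord0)) h h0.
Qed.

(* Kronecker's substitution x_i = t^(N^i) keeps the monomials apart. *)
Lemma meval_eq0 P : (forall x, meval x P = 0) -> P = 0.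
Proof.
move=> hP; pose N := mpoly.msize P.
pose K (m : multinom n) := (\sum_(i < n) m i * N ^ i)%N.
have hN m i : m \in msupp P -> (m i < N)%N.
  move=> mP; apply: leq_ltn_trans (msize_mdeg_lt mP).
  by rewrite mdegE (bigD1 i)//= leq_addr.
pose Q : {poly R} := \sum_(m <- msupp P) mcoeff m P *: 'X^(K m).
have Q0 : Q = 0.
  apply: (@poly_root_inj _ (fun i => i%:R)) => [i j /eqP|k].
    by rewrite eqr_nat => /eqP.
  rewrite -[RHS](hP (fun i => k%:R ^+ (N ^ i))) mevalE horner_sum.
  apply: eq_bigr => m _; rewrite hornerZ hornerXn; congr (_ * _).
  by rewrite /K expr_sum; apply: eq_bigr => i _; rewrite mulnC exprM.
apply/mpolyP => m; rewrite mcoeff0; apply/eqP; apply/negPn/negP => hm.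
have mP : m \in msupp P by rewrite mcoeff_msupp.
move/negP: hm; apply; apply/eqP; have := congr1 (fun q : {poly R} => q`_(K m)) Q0.
rewrite coef0 coef_sum (bigD1_seq m)//= coefZ coefXn eqxx mulr1 big_seq_cond.
rewrite big1 ?addr0// => k /andP[kP km]; rewrite coefZ coefXn.
case: eqP => [e|_]; last by rewrite mulr0.
case/eqP: km; apply/mnmP => i; apply/esym; move: i.
by apply: digits_inj e => i; apply: hN.
Qed.

Lemma meval_inj P Q : (forall x, meval x P = meval x Q) -> P = Q.
Proof.
move=> h; apply/eqP; rewrite -subr_eq0; apply/eqP/meval_eq0 => x.
by rewrite mevalB h subrr.
Qed.

Lemma meval_neq0 P : P != 0 -> exists x, meval x P != 0.
Proof.
move=> P0; apply: contrapT => h; case/eqP: P0; apply: meval_eq0 => x.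
by apply/eqP; apply: contra_notT h => hx; exists x.
Qed.

End lines.

Local Open Scope ring_scope.

(** * Gradients of pseudoconvex polynomials of odd degree *)

Section univariate.
Variable R : rcfType.
Implicit Type p : {poly R}.

Lemma poly_noroot_sg p s t : (forall t, p.[t] != 0) -> Num.sg p.[s] = Num.sg p.[t].
Proof.
by move=> h; apply: (@polyrN0_itv _ `]-oo, +oo[) => // x _; exact: h.
Qed.

Lemma poly_noroot_lead p t : (forall t, p.[t] != 0) ->
  Num.sg p.[t] = Num.sg (lead_coef p).
Proof.
move=> h; rewrite -[RHS]/(sgp_pinfty p) -(@sgp_pinftyP _ t _ _ t)//.
  by move=> x _; exact: h.
by rewrite in_itv /= lexx.
Qed.

(** At b and -b, with b the Cauchy bound of p - c, this polynomial has its signs at +oo and -oo.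
    They are opposite in odd degree, so one of the two points will do. *)
Lemma poly_odd_lt p c : odd (size p).-1 -> exists t, p.[t] < c.
Proof.
move=> op; pose q := p - c%:P.
have sq : size q = size p.
  rewrite /q size_polyDl// size_polyN (leq_ltn_trans (size_polyC_leq1 _))//.
  by move: op; case: (size p) => [|[|]].
have q0 : q != 0 by rewrite -size_poly_gt0 sq; move: op; case: (size p).
have b0 := cauchy_bound_ge0 q; pose b := cauchy_bound q.
have hp : Num.sg q.[b] = sgp_pinfty q.
  by apply: (sgp_pinftyP (ge_cauchy_bound q0)); rewrite in_itv /= lexx.
have hm : Num.sg q.[- b] = sgp_minfty q.
  by apply: (sgp_minftyP (le_cauchy_bound q0)); rewrite in_itv /= lexx.
move: hm; rewrite /sgp_minfty sq -signr_odd op expr1 mulN1r sgrN -[Num.sg (lead_coef q)]hp.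
have qb t : (p.[t] < c) = (q.[t] < 0) by rewrite hornerD hornerN hornerC subr_lt0.
have nz : q.[b] != 0.
  by apply: (ge_cauchy_bound q0); rewrite in_itv /= lexx.
have [lt|gt|e] := ltgtP q.[b] 0; last by rewrite e eqxx in nz.
  by exists b; rewrite qb.
by rewrite (gtr0_sg gt) => /eqP; rewrite sgr_cp0 -qb => h; exists (- b).
Qed.

End univariate.

Section criterion.
Variables (R : rcfType) (n : nat).
Implicit Types (P : mpoly n R) (x y v u : 'I_n -> R).

Definition dirD P v x : R := \sum_i v i * meval x (mderiv i P).

(** Pseudoconvexity in terms of formal derivatives, meaningful over any real closed field;
    [pseudoconvex_meval] links it to the analytic notion. *)
Definition mpseudoconvex P := forall x y,
  0 <= dirD P (fun i => y i - x i) x -> meval x P <= meval y P.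

Lemma line_deriv_horner P x v t :
  (line P x v)^`().[t] = dirD P v (fun i => x i + t * v i).
Proof.
rewrite line_deriv horner_sum; apply: eq_bigr => i _.
by rewrite hornerZ line_horner.
Qed.

Lemma line_deriv0 P x v : (line P x v)^`().[0] = dirD P v x.
Proof.
rewrite line_deriv_horner; apply: eq_bigr => i _; congr (_ * _).
by apply: meval_eq => j; rewrite mul0r addr0.
Qed.

Lemma line0 P x v : (line P x v).[0] = meval x P.
Proof. by rewrite line_horner; apply: meval_eq => j; rewrite mul0r addr0. Qed.

Lemma dirDZ P v x c : dirD P (fun i => c * v i) x = c * dirD P v x.
Proof. by rewrite /dirD big_distrr; apply: eq_bigr => i _ /=; rewrite mulrA. Qed.

Lemma dirDD P v u x : dirD P (fun i => v i + u i) x = dirD P v x + dirD P u x.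
Proof. by rewrite /dirD -big_split; apply: eq_bigr => i _; rewrite mulrDl. Qed.

Lemma dirD_eq P v u x : v =1 u -> dirD P v x = dirD P u x.
Proof. by move=> h; apply: eq_bigr => i _; rewrite h. Qed.

Definition unitv (j : 'I_n) : 'I_n -> R := fun i => (i == j)%:R.

Lemma dirD_unitv P j x : dirD P (unitv j) x = meval x (mderiv j P).
Proof.
rewrite /dirD (bigD1 j)//= /unitv eqxx mul1r big1 ?addr0// => i /negbTE ->.
by rewrite mul0r.
Qed.

Section forward.
Variables (d : nat) (P : mpoly n R).
Hypotheses (d_odd : odd d) (sP : mpoly.msize P = d.+1) (hP : mpseudoconvex P).

Let T := topP d P.

Let sP' : (mpoly.msize P <= d.+1)%N. Proof. by rewrite sP. Qed.

Lemma size_line_top x v : meval v T != 0 -> size (line P x v) = d.+1.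
Proof.
move=> h; apply/eqP; rewrite eqn_leq size_line//= ltnNge; apply/negP => le.
by case/eqP: h; rewrite -(coef_line x v sP') nth_default.
Qed.

(* A critical point of the restriction to a line would be a global minimum. *)
Lemma top_dirD_neq0 x v : meval v T != 0 -> dirD P v x != 0.
Proof.
move=> hv; apply/eqP => h0.
have [t] : exists t, (line P x v).[t] < meval x P.
  by apply: poly_odd_lt; rewrite (size_line_top x hv).
rewrite line_horner ltNge hP//.
rewrite (dirD_eq _ _ (_ : _ =1 fun i => t * v i)) ?dirDZ ?h0 ?mulr0// => i.
by rewrite addrC addKr.
Qed.

(** The derivative of P along the line has no real root, so its sign at 0 is that of its leading
    coefficient, d times the value of the top form at v. *)
Lemma top_dirD_sg x v : meval v T != 0 -> Num.sg (dirD P v x) = Num.sg (meval v T).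
Proof.
move=> hv; rewrite -line_deriv0 poly_noroot_lead => [|t]; last first.
  by rewrite line_deriv_horner top_dirD_neq0.
have d0 : (0 < d)%N by case: (d) d_odd.
rewrite lead_coefE size_deriv (size_line_top x hv) /= coef_deriv prednK//.
by rewrite coef_line// -mulr_natr sgrM [X in _ * X]gtr0_sg ?mulr1// ltr0n.
Qed.

(** The coefficient of degree d is T(u). In [ratio_le] this leaves only finitely many s with T(v - s
    u) = 0. *)
Lemma topP_line_neq0 v u : meval u T != 0 -> line T v u != 0.
Proof.
move=> hu; apply/eqP => l0; case/eqP: hu.
by rewrite /T -topP_idem -(coef_line v u (msize_topP d P)) -/T l0 coef0.
Qed.

(* With s_x = D_v P(x) / D_u P(x), the sign of the top form at v - s u is that
   of s_x - s for every x, so that s_x cannot depend on x. *)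
Lemma ratio_le u v x x' : 0 < meval u T ->
  dirD P v x' / dirD P u x' <= dirD P v x / dirD P u x.
Proof.
move=> hu; have hu0 : meval u T != 0 by rewrite gt_eqF.
have Du y : 0 < dirD P u y by rewrite -sgr_cp0 top_dirD_sg// gtr0_sg.
rewrite leNgt; apply/negP => lt; set a := _ / _ in lt; set b := _ / _ in lt.
have u0 : meval (fun i => - u i) T != 0 by rewrite topPN// oppr_eq0.
case/eqP: (topP_line_neq0 v u0).
(* The points s = a + (b - a) / (k + 2) lie strictly between a and b. At each of them T(v - s u)
   must vanish: otherwise the derivative in the direction v - s u would have the same sign at x and
   x', whereas a < s makes it negative at x and s < b makes it positive at x'. These are infinitely
   many roots of a nonzero polynomial. *)
apply: (@poly_root_inj _ _ (fun k => a + (b - a) / k.+2%:R)) => [i j|k].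
  move/addrI/(mulfI (_ : b - a != 0)); rewrite subr_eq0 gt_eqF// => /(_ isT).
  by move/invr_inj/eqP; rewrite eqr_nat => /eqP[].
set s := _ + _.
have as_ : a < s by rewrite ltrDl divr_gt0// ?subr_gt0.
have sb : s < b.
  rewrite -ltrBrDl ltr_pdivrMr ?ltr0n// ltr_pMr ?subr_gt0// ltr1n //.
rewrite line_horner; set w := fun i => _; apply/eqP/negPn/negP => hw.
have Dw y : dirD P w y = dirD P v y - s * dirD P u y.
  rewrite (dirD_eq _ _ (_ : w =1 fun i => v i + (- s) * u i)) ?dirDD ?dirDZ ?mulNr//.
  by move=> i; rewrite /w mulrN mulNr.
have e1 := top_dirD_sg x hw; have e2 := top_dirD_sg x' hw.
have : dirD P w x < 0 by rewrite Dw subr_lt0 -ltr_pdivrMr.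
rewrite -sgr_cp0 e1 -e2 sgr_cp0 Dw subr_lt0 -ltr_pdivrMr//.
by move/(lt_trans sb); rewrite ltxx.
Qed.

(** [ratio_le] used both ways makes D_j P / D_u P a constant s_j. Not all s_j are 0, since D_u P is
    positive; dividing by a nonzero s_I normalizes the direction. *)
Lemma grad_direction : exists (I : 'I_n) (xi : 'I_n -> R),
  [/\ xi I = 1, forall j, mderiv j P = xi j *: mderiv I P &
      forall x, meval x (mderiv I P) != 0].
Proof.
have P0 : P != 0 by rewrite -msize_poly_eq0 sP.
have T0 : T != 0.
  apply/eqP => e; have := mleadc_eq0 P; rewrite (negbTE P0) => /eqP; apply.
  by rewrite -(@mcoeff_topP _ _ d) -/T ?e ?mcoeff0//; apply/eqP; rewrite -eqSS mlead_deg// sP.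
have [u hu] : exists u, 0 < meval u T.
  have [u] := meval_neq0 T0; rewrite neq_lt => /orP[lt|gt]; last by exists u.
  by exists (fun i => - u i); rewrite topPN// oppr_gt0.
have hu0 : meval u T != 0 by rewrite gt_eqF.
have Du y : 0 < dirD P u y by rewrite -sgr_cp0 top_dirD_sg// gtr0_sg.
pose z : 'I_n -> R := fun=> 0.
pose s j := dirD P (unitv j) z / dirD P u z.
have sE j x : meval x (mderiv j P) = s j * dirD P u x.
  have -> : s j = dirD P (unitv j) x / dirD P u x.
    by apply/eqP; rewrite eq_le /s !ratio_le.
  by rewrite divfK ?dirD_unitv// gt_eqF.
have [I sI] : exists I, s I != 0.
  apply: contrapT => h; have := Du z; rewrite {1}/dirD big1 ?ltxx// => i _.
  rewrite sE; have [->|hi] := eqVneq (s i) 0; first by rewrite mul0r mulr0.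
  by case: h; exists i.
exists I, (fun j => s j / s I); split => [|j|x]; first by rewrite divff.
  apply: meval_inj => x; rewrite mevalZ !sE mulrA divfK//.
by rewrite sE mulf_neq0// gt_eqF.
Qed.

End forward.

End criterion.

Local Open Scope ring_scope.

(** * A criterion on the coefficients *)

Lemma mnm_ind (n : nat) (Q : multinom n -> Prop) :
  Q mnm0 -> (forall j m, Q m -> Q (mnm_add (mnm1 j) m)) -> forall m, Q m.
Proof.
move=> Q0 QS m; rewrite -[m]addm0 {1}[m]multinomUE_id.
elim/big_rec: _ => [|i k _ IH]; first by rewrite add0m.
rewrite -addmA; elim: (m i) => [|l IHl]; first by rewrite mulm0n add0m.
by rewrite mulmS -addmA; apply: QS.
Qed.

Definition Uk n (I : 'I_n) (k : nat) : multinom n := mnm_muln (mnm1 I) k.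

Section taylor.
Variables (F : fieldType) (n : nat).
Implicit Types (P : mpoly n F) (m : multinom n).

(** The partial derivative of order [m] at 0, see [tayE]. In terms of derivatives, rather than
    coefficients, the relations below are free of factorials. *)
Definition tay P m : F := mcoeff m P *+ (\prod_i (m i)`!)%N.

Lemma tayE P m : tay P m = mcoeff mnm0 (mderivm m P).
Proof.
rewrite mcoeff_mderivm addm0 /tay; congr (_ *+ _).
by apply: eq_bigr => i _; rewrite ffactnn.
Qed.

Lemma tay_mderiv P j m : tay (mderiv j P) m = tay P (mnm_add (mnm1 j) m).
Proof. by rewrite !tayE mderivmDm mderivmU1m. Qed.

Lemma tayZ c P m : tay (c *: P) m = c * tay P m.
Proof. by rewrite /tay mcoeffZ mulrnAr. Qed.

(* If P(x) = h(xi . x) with xi_I = 1 then tay P m = h^(|m|)(0) xi^m, so that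
   xi_j = tayB j / tayB I, and crit_poly is h'. *)
Definition tayB d P I j : F := tay P (mnm_add (mnm1 j) (Uk I d.-1)).

(** The relation d^m P(0) = h^(|m|)(0) xi^m multiplied by B_I^|m|, which removes the division from
    xi_j = B_j / B_I. *)
Definition mcrit d P I : Prop := tayB d P I I != 0 /\
  forall m, (mdeg m <= d)%N -> tay P m * tayB d P I I ^+ mdeg m =
    tay P (Uk I (mdeg m)) * \prod_j tayB d P I j ^+ m j.

Definition crit_poly d P I : {poly F} :=
  \poly_(k < d) (tay P (Uk I k.+1) / k`!%:R).

Lemma mnm_prodD (xi : 'I_n -> F) m1 m2 : \prod_j xi j ^+ mnm_add m1 m2 j =
  (\prod_j xi j ^+ m1 j) * \prod_j xi j ^+ m2 j.
Proof. by rewrite -big_split; apply: eq_bigr => j _; rewrite mnmE exprD. Qed.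

Lemma mnm_prod1 (xi : 'I_n -> F) j : \prod_i xi i ^+ mnm1 j i = xi j.
Proof.
rewrite (bigD1 j)//= mnm1E eqxx big1 ?mulr1// => i ij.
by rewrite mnm1E eq_sym (negbTE ij).
Qed.

(** Each derivative along x_j is traded for xi_j times one along x_I. The induction is over all P at
    once, because it passes to D_I P, whose gradient has the same direction. *)
Lemma tay_direction (xi : 'I_n -> F) I P m :
  (forall j, mderiv j P = xi j *: mderiv I P) ->
  tay P m = (\prod_j xi j ^+ m j) * tay P (Uk I (mdeg m)).
Proof.
elim/mnm_ind: m P => [|j m IH] P hP.
  by rewrite mdeg0 /Uk mulm0n big1 ?mul1r// => j _; rewrite mnmE.
rewrite -tay_mderiv hP tayZ IH => [|i].
  by rewrite mnm_prodD mnm_prod1 mulrA mdegD mdeg1 add1n /Uk mulmS tay_mderiv.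
by rewrite mderiv_comm hP mderivZ.
Qed.

Lemma mdeg_Uk (I : 'I_n) k : mdeg (Uk I k) = k.
Proof. by rewrite mdegMn mdeg1 mul1n. Qed.

Lemma prod_Uk (xi : 'I_n -> F) I k : \prod_j xi j ^+ Uk I k j = xi I ^+ k.
Proof.
elim: k => [|k IH]; first by rewrite big1 // => i _; rewrite /Uk mulm0n mnmE.
by rewrite /Uk mulmS mnm_prodD mnm_prod1 -/(Uk I k) IH exprS.
Qed.

Lemma mcrit_direction d (xi : 'I_n -> F) I P : (0 < d)%N ->
  tay P (Uk I d) != 0 -> xi I = 1 ->
  (forall j, mderiv j P = xi j *: mderiv I P) -> mcrit d P I.
Proof.
move=> d0 hd xI hP; pose G := tay P (Uk I d).
have hB j : tayB d P I j = xi j * G.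
  rewrite /tayB (tay_direction _ hP) mnm_prodD mnm_prod1 prod_Uk xI expr1n mulr1.
  by rewrite mdegD mdeg1 mdeg_Uk add1n prednK.
split=> [|m _]; first by rewrite hB xI mul1r.
under [X in _ = _ * X]eq_bigr do rewrite hB exprMn.
rewrite hB xI mul1r big_split /= -expr_sum -mdegE (tay_direction m hP).
by rewrite mulrA [X in _ = X * _]mulrC -!mulrA.
Qed.

End taylor.

Section char0.
Variables (F : numFieldType) (n : nat).
Implicit Types (P Q : mpoly n F) (m : multinom n).

Lemma tay_inj P Q : (forall m, tay P m = tay Q m) -> P = Q.
Proof.
move=> h; apply/mpolyP => m; apply/eqP; have /eqP := h m.
rewrite /tay eqrMn2r// (_ : _ == 0%N = false)//; apply/negbTE.
by rewrite -lt0n prodn_gt0// => i; rewrite fact_gt0.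
Qed.

(** In characteristic 0 it suffices to compare all derivatives at 0. Those of P up to order d are
    given by [mcrit], and the higher ones vanish. *)
Lemma mcrit_mderiv d P I j : (mpoly.msize P <= d.+1)%N -> mcrit d P I ->
  mderiv j P = (tayB d P I j / tayB d P I I) *: mderiv I P.
Proof.
move=> sP [b0 h]; pose xi j := tayB d P I j / tayB d P I I.
have hm m : (mdeg m <= d)%N -> tay P m = tay P (Uk I (mdeg m)) * \prod_j xi j ^+ m j.
  move=> hm; apply: (mulIf (expf_neq0 (mdeg m) b0)); rewrite h// -mulrA; congr (_ * _).
  rewrite mdegE expr_sum -big_split /=; apply: eq_bigr => i _.
  by rewrite -exprMn divfK.
have hm0 m : (d < mdeg m)%N -> tay P m = 0.
  move=> lt; rewrite /tay memN_msupp_eq0 ?mul0rn//.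
  by rewrite msize_mdeg_ge// (leq_trans sP).
apply: tay_inj => m; rewrite tayZ !tay_mderiv.
have xI : xi I = 1 by rewrite /xi divff.
have [le|lt] := leqP (mdeg m) d.-1; last first.
  by rewrite !hm0 ?mulr0// mdegD mdeg1; move: lt; case: (d).
have [d0|d0] := posnP d.
  by rewrite !hm0 ?mulr0// mdegD mdeg1 d0.
have hS i : tay P (mnm_add (mnm1 i) m) =
    tay P (Uk I (mdeg m).+1) * (xi i * \prod_j xi j ^+ m j).
  by rewrite hm mdegD mdeg1 add1n ?mnm_prodD ?mnm_prod1// -(prednK d0).
by rewrite !hS xI mul1r mulrCA.
Qed.

End char0.

Section criterion.
Variables (R : rcfType) (n d : nat) (P : mpoly n R).
Hypotheses (d_odd : odd d) (sP : mpoly.msize P = d.+1).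

Let sP' : (mpoly.msize P <= d.+1)%N. Proof. by rewrite sP. Qed.

Lemma meval_zero (Q : mpoly n R) : meval (fun=> 0) Q = mcoeff mnm0 Q.
Proof.
elim/mpoly_ring_ind: Q => [c|i|p q IHp IHq|p q IHp IHq].
- by rewrite mevalC mcoeffC eqxx mulr1.
- rewrite mevalXU mcoeffX; case: eqP => // /(congr1 (fun m : multinom n => m i)).
  by rewrite !mnmE eqxx.
- by rewrite mevalD mcoeffD IHp IHq.
- by rewrite mevalM IHp IHq rmorphM.
Qed.

Lemma line_unitv_deriv (Q : mpoly n R) I x :
  (line Q x (unitv R I))^`() = line (mderiv I Q) x (unitv R I).
Proof.
rewrite line_deriv (bigD1 I)//= /unitv eqxx scale1r big1 ?addr0// => i /negbTE ->.
by rewrite scale0r.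
Qed.

Lemma line_unitv_coef (Q : mpoly n R) I k :
  (line Q (fun=> 0) (unitv R I))`_k *+ k`! = tay Q (Uk I k).
Proof.
transitivity (line Q (fun=> 0) (unitv R I))^`(k).[0].
  by rewrite horner_coef0 coef_derivn addn0 ffactnn.
elim: k Q => [|k IH] Q.
  by rewrite derivn0 line0 meval_zero tayE /Uk mulm0n mderivm0m.
by rewrite derivSn line_unitv_deriv IH tay_mderiv /Uk mulmS.
Qed.

(** With xi_I = 1 the coordinate on the x_I-axis is xi . x itself, so h' is the restriction of D_I P
    to this axis. *)
Lemma crit_polyE I : crit_poly d P I = line (mderiv I P) (fun=> 0) (unitv R I).
Proof.
rewrite -line_unitv_deriv; apply/polyP => k; rewrite coef_poly coef_deriv.
case: ltnP => hk; last by rewrite nth_default ?mul0rn// (leq_trans (size_line _ _ sP')).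
rewrite -line_unitv_coef factS mulrnA -[X in X / _]mulr_natr mulfK//.
Qed.

Lemma crit_poly_horner I t :
  (crit_poly d P I).[t] = meval (fun i => t * unitv R I i) (mderiv I P).
Proof.
by rewrite crit_polyE line_horner; apply: meval_eq => i; rewrite add0r.
Qed.

Lemma pseudoconvex_mcrit : mpseudoconvex P ->
  exists I, mcrit d P I /\ forall t, (crit_poly d P I).[t] != 0.
Proof.
move=> hP; have [I [xi [xI hxi hg]]] := grad_direction d_odd sP hP.
exists I; split => [|t]; last by rewrite crit_poly_horner.
have d0 : (0 < d)%N by case: (d) d_odd.
(* What remains is h^(d)(0) <> 0: up to a factorial, the leading coefficient of P is a multiple of
   it. *)
apply: (mcrit_direction d0 _ xI hxi); apply/negP => /eqP hG.
have P0 : P != 0 by rewrite -msize_poly_eq0 sP.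
have md : mdeg (mlead P) = d by apply/eqP; rewrite -eqSS mlead_deg// sP.
have := tay_direction (mlead P) hxi; rewrite md hG mulr0 => /eqP.
rewrite /tay mulrn_eq0 mleadc_eq0 (negbTE P0) orbF; apply/negP.
by rewrite -lt0n prodn_gt0// => i; rewrite fact_gt0.
Qed.

(** No h is constructed. D_I P is constant in the directions orthogonal to xi, so its value at x is
    that of [crit_poly] at xi . x, hence nonzero. Thus D_I P has one sign on each line, and the mean
    value theorem gives P(y) - P(x) = (xi . (y - x)) D_I P(z) for some z on the segment, which has
    the sign of (xi . (y - x)) D_I P(x). *)
Lemma mcrit_pseudoconvex I : mcrit d P I ->
  (forall t, (crit_poly d P I).[t] != 0) -> mpseudoconvex P.
Proof.
move=> hI ht; pose xi j := tayB d P I j / tayB d P I I.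
have hxi j : mderiv j P = xi j *: mderiv I P by exact: mcrit_mderiv.
have xI : xi I = 1 by case: hI => b0 _; rewrite /xi divff.
pose q := mderiv I P; pose dot (v : 'I_n -> R) := \sum_i v i * xi i.
have dirq v x : dirD q v x = dot v * meval x (mderiv I q).
  rewrite /dirD /dot big_distrl; apply: eq_bigr => i _ /=.
  by rewrite -mulrA /q mderiv_comm hxi mderivZ mevalZ.
have dirP v x : dirD P v x = dot v * meval x q.
  rewrite /dirD /dot big_distrl; apply: eq_bigr => i _ /=.
  by rewrite -mulrA hxi mevalZ.
have q_neq0 x : meval x q != 0.
  pose z i := dot x * unitv R I i; pose w i := x i - z i.
  have w0 : dot w = 0.
    rewrite /dot /w; under eq_bigr do rewrite mulrBl.
    rewrite sumrB -/(dot x) (bigD1 I)//= big1.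
      by rewrite /z /unitv eqxx xI !mulr1 addr0 subrr.
    by move=> i /negbTE iI; rewrite /z /unitv iI mulr0 mul0r.
  have [c _] := poly_mvt (line q z w) (@ltr01 R).
  rewrite line_deriv_horner dirq w0 !mul0r => /eqP.
  rewrite subr_eq0 line0 line_horner (@meval_eq _ _ _ x) => [|i].
    by move=> /eqP ->; rewrite -crit_poly_horner.
  by rewrite mul1r addrC subrK.
move=> x y; rewrite dirP; set S := dot _ => hS.
have [c _] := poly_mvt (line P x (fun i => y i - x i)) (@ltr01 R).
rewrite line_deriv_horner dirP line0 line_horner -/S subr0 mulr1.
rewrite (@meval_eq _ _ _ y) => [|i]; last by rewrite mul1r addrC subrK.
rewrite -subr_ge0 => ->; set z := fun i => _.
have : Num.sg (line q x (fun i => y i - x i)).[0] = Num.sg (line q x (fun i => y i - x i)).[c].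
  by apply: poly_noroot_sg => t; rewrite line_horner.
rewrite line0 line_horner -/z => e.
by rewrite -sgr_ge0 sgrM -e -sgrM sgr_ge0.
Qed.

End criterion.

Local Open Scope ring_scope.

(** * From differentiable functions to formal derivatives and rational coefficients *)

Section analysis.
Variables (R : realType) (n : nat).

Lemma differentiable_meval (P : mpoly n R) (x : 'rV[R]_n) :
  differentiable (fun y : 'rV[R]_n => meval (fun i => y 0 i) P) x /\
  forall j, 'D_(delta_mx 0 j) (fun y : 'rV[R]_n => meval (fun i => y 0 i) P) x
    = meval (fun i => x 0 i) (mderiv j P).
Proof.
elim/mpoly_ring_ind: P => [c|i|p q [dp Dp] [dq Dq]|p q [dp Dp] [dq Dq]].
- rewrite (_ : (fun y => _) = cst c); last by apply/funext => y; rewrite mevalC.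
  by split=> [|j]; [exact: differentiable_cst|rewrite derive_cst mderivC meval0].
- rewrite (_ : (fun y => _) = (fun y : 'rV[R]_n => y 0 i)); last first.
    by apply/funext => y; rewrite mevalXU.
  have dc : differentiable (fun y : 'rV[R]_n => y 0 i) x by exact: differentiable_coord.
  split=> // j.
  have f_lin : linear (fun y : 'rV[R]_n => y 0 i) by move=> a u v; rewrite !mxE.
  pose L := GRing.isLinear.Build _ _ _ _ _ f_lin.
  pose g : {linear 'rV[R]_n -> R} := HB.pack (fun y : 'rV[R]_n => y 0 i) L.
  rewrite deriveE// (_ : (fun y : 'rV[R]_n => y 0 i) = g)// diff_lin; last first.
    by move=> y; apply: differentiable_continuous; exact: differentiable_coord.
  rewrite /= mxE eqxx /= mderivX mnm1E eq_sym.
  have [->|ne] := eqVneq i j; last by rewrite scale0r meval0.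
  rewrite scale1r (_ : mnm_sub _ _ = mnm0) ?mpolyX0 ?meval1//.
  by apply/mnmP => k; rewrite mnmE subnn mnmE.
- rewrite (_ : (fun y => _) = (fun y : 'rV[R]_n => meval (fun i => y 0 i) p) +
    (fun y : 'rV[R]_n => meval (fun i => y 0 i) q)); last first.
    by apply/funext => y; rewrite mevalD.
  split=> [|j]; first exact: differentiableD.
  by rewrite deriveD ?Dp ?Dq ?mderivD ?mevalD//; exact: diff_derivable.
- rewrite (_ : (fun y => _) = (fun y : 'rV[R]_n => meval (fun i => y 0 i) p) *
    (fun y : 'rV[R]_n => meval (fun i => y 0 i) q)); last first.
    by apply/funext => y; rewrite mevalM.
  split=> [|j]; first exact: differentiableM.
  rewrite deriveM; try exact: diff_derivable.
  rewrite Dp Dq mderivM mevalD !mevalM addrC; congr (_ + _); exact: mulrC.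
Qed.

Lemma pseudoconvex_meval (p : mpoly n rat) :
  pseudoconvex (polyfun R p) <-> mpseudoconvex (map_mpoly (@ratr R) p).
Proof.
set P := map_mpoly _ p.
have gE (x y : 'rV[R]_n) : dotp (gradient (polyfun R p) x) (y - x) =
    dirD P (fun i => y 0 i - x 0 i) (fun i => x 0 i).
  apply: eq_bigr => i _; rewrite !mxE mulrC; congr (_ * _).
  by have [_] := differentiable_meval P x; apply.
split=> [[_ h] x y hxy|h]; last first.
  split=> [x|x y]; first by have [] := differentiable_meval P x.
  by rewrite gE; exact: h.
have e z : (fun i => (\row_i z i : 'rV[R]_n) 0 i) = z.
  by apply/funext => i; rewrite mxE.
have := h (\row_i x i) (\row_i y i); rewrite gE /polyfun !e; apply.
by rewrite (dirD_eq _ _ (_ : _ =1 fun i => y i - x i))// => i; rewrite !mxE.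
Qed.

Lemma tay_ratr (p : mpoly n rat) m :
  tay (map_mpoly (@ratr R) p) m = ratr (tay p m).
Proof. by rewrite /tay mcoeff_map_mpoly rmorphMn. Qed.

(** The conditions are equations and one inequation between images of rationals, and [ratr] is an
    injective morphism. This lets the program decide them exactly. *)
Lemma mcrit_ratr (p : mpoly n rat) d I :
  mcrit d (map_mpoly (@ratr R) p) I <-> mcrit d p I.
Proof.
have hB j : tayB d (map_mpoly (@ratr R) p) I j = ratr (tayB d p I j) by exact: tay_ratr.
have hP m : \prod_j tayB d (map_mpoly (@ratr R) p) I j ^+ m j =
    ratr (\prod_j tayB d p I j ^+ m j).
  by rewrite rmorph_prod; apply: eq_bigr => j _; rewrite hB rmorphXn.
split=> -[b0 h]; split.
- by move: b0; rewrite hB fmorph_eq0.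
- move=> m /h; rewrite hP hB !tay_ratr -rmorphXn -!rmorphM; exact: fmorph_inj.
- by rewrite hB fmorph_eq0.
- by move=> m /h e; rewrite hP hB !tay_ratr -rmorphXn -!rmorphM e.
Qed.

Lemma crit_poly_ratr (p : mpoly n rat) d I :
  crit_poly d (map_mpoly (@ratr R) p) I = map_poly (@ratr R) (crit_poly d p I).
Proof.
apply/polyP => k; rewrite coef_map !coef_poly; case: ifP => _; last by rewrite raddf0.
by rewrite tay_ratr /= rmorphM fmorphV rmorph_nat.
Qed.

Lemma msize_ratr (p : mpoly n rat) :
  mpoly.msize (map_mpoly (@ratr R) p) = mpoly.msize p.
Proof.
by rewrite !msizeE; apply: perm_big; apply: msupp_map_mpoly; exact: fmorph_inj.
Qed.

Lemma pseudoconvexP d (p : mpoly n rat) : odd d -> mpoly.msize p = d.+1 ->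
  pseudoconvex (polyfun R p) <-> exists I, mcrit d p I /\
    forall t : R, (map_poly (@ratr R) (crit_poly d p I)).[t] != 0.
Proof.
move=> od sp; rewrite pseudoconvex_meval; have sP := sp; rewrite -msize_ratr in sP.
split=> [/(pseudoconvex_mcrit od sP)[I [hI ht]]|[I [hI ht]]].
  by exists I; split; [apply/mcrit_ratr|move=> t; rewrite -crit_poly_ratr].
apply: (@mcrit_pseudoconvex _ _ d _ sP I) => [|t]; first by apply/mcrit_ratr.
by rewrite crit_poly_ratr.
Qed.

End analysis.

Local Open Scope nat_scope.

(** * Words and the input array *)

Lemma mem_mon_words n lo k u : (u \in mon_words n lo k) =
  [&& size u == k, path leq lo u & all (fun x => x < n) u].
Proof.
elim: k lo u => [|k IH] lo [|x u] //=.
  by apply/negbTE/negP => /flatten_mapP[i _ /mapP[v _]].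
rewrite eqSS; apply/flatten_mapP/idP => [[i + /mapP[v + [-> ->]]]|].
  by rewrite IH mem_iota => hi /and3P[-> -> ->]; rewrite /= !andbT; lia.
move=> /and3P[/eqP su /andP[lx pu] /andP[xn au]]; exists x; first by rewrite mem_iota; lia.
by apply/mapP; exists u; rewrite // IH su eqxx pu au.
Qed.

Definition words n d := flatten [seq mon_words n 0 k | k <- iota 0 d.+1].

Lemma mem_words n d u : (u \in words n d) =
  [&& size u <= d, sorted leq u & all (fun x => x < n) u].
Proof.
have p0 : path leq 0 u = sorted leq u by case: u.
apply/flatten_mapP/idP => [[k]|/and3P[su so au]].
  by rewrite mem_iota mem_mon_words p0 => /= hk /and3P[/eqP -> -> ->]; rewrite -ltnS hk.
by exists (size u); rewrite ?mem_iota ?mem_mon_words ?p0 ?so ?au ?eqxx.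
Qed.

Section multinomials.
Variable n : nat.
Implicit Types (u v : seq nat) (I j : 'I_n).

Lemma mnm_of_wordE u i : mnm_of_word n u i = count_mem (i : nat) u.
Proof. exact: mnmE. Qed.

Lemma mnm_of_word_perm u v : perm_eq u v -> mnm_of_word n u = mnm_of_word n v.
Proof.
by move=> /permP h; apply/mnmP => i; rewrite !mnm_of_wordE h.
Qed.

Lemma mnm_of_word_cons j u :
  mnm_of_word n ((j : nat) :: u) = mnm_add (mnm1 j) (mnm_of_word n u).
Proof. by apply/mnmP => i; rewrite mnmDE mnm1E !mnm_of_wordE. Qed.

Lemma mnm_of_word_nil : mnm_of_word n [::] = mnm0.
Proof. by apply/mnmP => i; rewrite [LHS]mnm_of_wordE [RHS]mnmE. Qed.

Lemma mnm_of_word_nseq I k : mnm_of_word n (nseq k (I : nat)) = Uk I k.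
Proof.
elim: k => [|k IH]; first by rewrite /Uk mulm0n mnm_of_word_nil.
by rewrite /= mnm_of_word_cons IH /Uk mulmS.
Qed.

Lemma mdeg_mnm_of_word u : all (fun x => x < n) u -> mdeg (mnm_of_word n u) = size u.
Proof.
elim: u => [_|x u IH /= /andP[xn /IH <-]]; first by rewrite mnm_of_word_nil mdeg0.
by rewrite (mnm_of_word_cons (Ordinal xn)) mdegD mdeg1.
Qed.

Lemma mnm_of_word_prod (F : fieldType) (f : nat -> F) u :
  all (fun x => x < n) u ->
  (\prod_(x <- u) f x = \prod_(j < n) f j ^+ mnm_of_word n u j)%R.
Proof.
elim: u => [_|x u IH /= /andP[xn /IH e]].
  by rewrite big_nil mnm_of_word_nil big1// => j _; rewrite mnm0E.
rewrite big_cons e (mnm_of_word_cons (Ordinal xn)).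
by rewrite (mnm_prodD (fun j => f j)) (mnm_prod1 (fun j : 'I_n => f j)).
Qed.

Lemma mnm_of_word_surj d (m : multinom n) : mdeg m <= d ->
  exists2 u, u \in words n d & mnm_of_word n u = m.
Proof.
move=> hm; pose u := flatten [seq nseq (m i) (i : nat) | i <- enum 'I_n].
have cu j : count_mem (j : nat) u = m j.
  rewrite /u count_flatten sumnE !big_map -/(index_enum _) (bigD1 j)//=.
  rewrite count_nseq /= eqxx mul1n big1 ?addn0// => i ij.
  by rewrite count_nseq /= val_eqE (negbTE ij).
have au : all (fun x => x < n) u.
  by apply/allP => x /flatten_mapP[i _ /nseqP[-> _]].
have mu : mnm_of_word n u = m by apply/mnmP => j; rewrite mnm_of_wordE cu.
have pu : perm_eq (sort leq u) u by rewrite perm_sort.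
exists (sort leq u); last by rewrite (mnm_of_word_perm pu).
rewrite mem_words (perm_size pu) -mdeg_mnm_of_word// mu hm (perm_all _ pu) au.
by rewrite sort_sorted//; exact: leq_total.
Qed.

(* m! for the multi-index m of u: a letter contributes the number of its
   occurrences up to its position. *)
Definition fact_word (u : seq nat) : nat :=
  \prod_(0 <= l < size u) \sum_(0 <= k < l.+1) (nth 0 u k == nth 0 u l).

(** Induction from the right: a new last letter x contributes m_x + 1, in accordance with (m_x + 1)!
    = (m_x + 1) m_x!. *)
Lemma fact_wordE u : all (fun x => x < n) u ->
  fact_word u = \prod_(i < n) (mnm_of_word n u i)`!.
Proof.
elim/last_ind: u => [_|u x IH].
  by rewrite /fact_word big_nil big1// => i _; rewrite mnm_of_wordE.
rewrite all_rcons => /andP[xn au].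
have pu : perm_eq (rcons u x) (x :: u) by rewrite perm_rcons.
rewrite (mnm_of_word_perm pu) (mnm_of_word_cons (Ordinal xn)).
rewrite (bigD1 (Ordinal xn))//= mnmDE mnm1E eqxx add1n factS -mulnA.
rewrite (eq_bigr (fun i => (mnm_of_word n u i)`!)); last first.
  by move=> i ix; rewrite mnmDE mnm1E eq_sym (negbTE ix).
rewrite -(bigD1 (Ordinal xn) (P := xpredT))//= -IH//.
rewrite /fact_word size_rcons big_nat_recr//= mulnC; congr (_ * _).
  rewrite nth_rcons ltnn eqxx big_nat_recr//= nth_rcons ltnn !eqxx addn1; congr _.+1.
  rewrite mnm_of_wordE -sum1_count [RHS](big_nth 0) [RHS]big_mkcond.
  rewrite big_nat_cond [RHS]big_nat_cond.
  by apply: eq_bigr => k /andP[/andP[_ ku] _]; rewrite nth_rcons ku.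
apply: eq_big_nat => l /andP[_ lu]; apply: eq_big_nat => k /andP[_ kl].
by rewrite !nth_rcons lu (leq_ltn_trans _ lu)// -ltnS.
Qed.

Lemma fact_word_le u : fact_word u <= (size u)`!.
Proof.
rewrite /fact_word fact_prod big_add1 /=.
apply: leq_prod => l _; apply: leq_trans (_ : \sum_(0 <= k < l.+1) 1 <= _).
  by apply: leq_sum => k _; case: eqP.
by rewrite sum1_size size_iota subn0.
Qed.

End multinomials.

Lemma nth_flatten2 (T U : Type) (x0 : U) (t0 : T) (f g : T -> U) (s : seq T) i :
  i < size s ->
  nth x0 (flatten [seq [:: f t; g t] | t <- s]) i.*2 = f (nth t0 s i) /\
  nth x0 (flatten [seq [:: f t; g t] | t <- s]) i.*2.+1 = g (nth t0 s i).
Proof.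
by elim: s i => [|t s IH] [|i]//=; rewrite ltnS => /IH.
Qed.

Section encoding.
Variables (d n : nat) (p : mpoly n rat).

Definition word_coef (u : seq nat) : rat := mcoeff (mnm_of_word n u) p.

Lemma nth_encode0 : nth 0%R (encode_poly d p) 0 = Posz n.
Proof. by []. Qed.

(** Cell 0 holds n, so the pair of the i-th word starts at 1 + 2i. *)
Lemma nth_encode i : i < size (words n d) ->
  nth 0%R (encode_poly d p) (1 + i.*2) = numq (word_coef (nth [::] (words n d) i)) /\
  nth 0%R (encode_poly d p) (2 + i.*2) = denq (word_coef (nth [::] (words n d) i)).
Proof.
rewrite /encode_poly /monomials -map_comp -/(words n d) => hi.
by have := nth_flatten2 0%R [::] (numq \o word_coef) (denq \o word_coef) hi.
Qed.

Lemma size_encode : size (encode_poly d p) = (size (words n d)).*2.+1.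
Proof.
rewrite /encode_poly /monomials -map_comp -/(words n d); move: (words n d) => s.
by congr _.+1; elim: s => [|u s IH] //; rewrite [LHS]/= IH.
Qed.

Lemma tay_word u : all (fun x => x < n) u ->
  tay p (mnm_of_word n u) =
  ((numq (word_coef u) * Posz (fact_word u))%:~R / (denq (word_coef u))%:~R)%R.
Proof.
move=> hu; rewrite /tay -fact_wordE// rmorphM /= mulrAC divq_num_den.
by rewrite mulr_natr.
Qed.

Lemma size_le_input (w : seq int) : size w <= input_size w.
Proof.
rewrite /input_size -sum1_size; apply: leq_sum => z _; exact: leq_trans (leqnn 1) _.
Qed.

Lemma bitlen_nth (w : seq int) i : 0 < size w -> bitlen (nth 0%R w i) <= input_size w.
Proof.
move=> w0; have [iw|iw] := ltnP i (size w).
  by rewrite /input_size (big_rem (nth 0%R w i)) ?mem_nth//= leq_addr.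
by rewrite nth_default// (leq_trans _ (size_le_input w)).
Qed.

End encoding.

Section almost_constant.
Variables (d I : nat).
Hypothesis d_gt0 : 0 < d.

(* The word of x_I^(d-1) x_j. *)
Definition spike (j : nat) : seq nat := sort leq (j :: nseq d.-1 I).

Lemma size_spike j : size (spike j) = d.
Proof. by rewrite size_sort /= size_nseq prednK. Qed.

Lemma spike_words n j : I < n -> j < n -> spike j \in words n d.
Proof.
move=> hI hj; rewrite mem_words size_spike leqnn.
rewrite sort_sorted ?all_sort /=; last exact: leq_total.
by rewrite hj all_nseq hI orbT.
Qed.

Lemma nseq_words n k : I < n -> k <= d -> nseq k I \in words n d.
Proof.
move=> hI hk; rewrite mem_words size_nseq hk all_nseq hI orbT andbT /=.
by elim: k {hk} => [|[|k] IH]//=; rewrite leqnn.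
Qed.

(** At most one letter differs from I. It can be computed from the sum of the letters, without a
    search for its position. *)
Lemma spike_of_count u : size u = d -> sorted leq u -> d.-1 <= count_mem I u ->
  exists2 j, j \in u & u = spike j /\ \sum_(x <- u) x = j + d.-1 * I.
Proof.
move=> su so hc.
have [j pu] : exists j, perm_eq u (j :: nseq d.-1 I).
  have fE : seq.filter (pred1 I) u = nseq (count_mem I u) I.
    by elim: (u) => //= x s ->; case: eqVneq => [->|].
  have : perm_eq u (nseq (count_mem I u) I ++ seq.filter (predC (pred1 I)) u).
    by rewrite -fE perm_sym perm_filterC.
  move=> pu; have := perm_size pu; rewrite size_cat size_nseq su; move: pu.
  move: (count_mem I u) hc => c; case: (seq.filter _ u) => [|j [|j' v]] /= hc pu e.
  - exists I; rewrite (perm_trans pu)// cats0 (_ : c = d.-1.+1)//; lia.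
  - exists j; rewrite (perm_trans pu)// perm_catC /= (_ : c = d.-1)//; lia.
  - lia.
exists j; first by rewrite (perm_mem pu) mem_head.
split; last by rewrite (perm_big _ pu) big_cons /= big_nseq iter_addn_0 mulnC.
rewrite -[LHS](sorted_sort leq_trans so); apply/perm_sortP => //.
- exact: leq_total.
- exact: leq_trans.
- exact: anti_leq.
Qed.

End almost_constant.

Lemma mnm_of_word_spike n d (I j : 'I_n) :
  mnm_of_word n (spike d I j) = mnm_add (mnm1 j) (Uk I d.-1).
Proof.
rewrite -mnm_of_word_nseq -mnm_of_word_cons.
by apply: mnm_of_word_perm; rewrite perm_sort.
Qed.

Local Open Scope nat_scope.

(** * Total correctness with time bounds *)

Section wp.
Variables (w : seq int) (L : nat).
Implicit Types (s : store) (c : stmt) (Q : store -> Prop).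

(** Termination, time and the bound on stored values are part of the judgment, so that
    postconditions [Q] speak of contents only. *)
Definition wp c s (t : nat) Q : Prop := sbound L s ->
  exists s' t', [/\ exec w L c s t' s', t' <= t, sbound L s' & Q s'].

Lemma wp_weaken c s t t' Q Q' : t <= t' -> (forall s', Q s' -> Q' s') ->
  wp c s t Q -> wp c s t' Q'.
Proof.
move=> ht hQ h /h[s1 [t1 [h1 h2 h3 h4]]]; exists s1, t1; split=> //.
  exact: leq_trans ht.
exact: hQ.
Qed.

Lemma wp_put e1 e2 s Q : (sbound L s -> bitlen (evale w s e2) <= L) ->
  Q (upd s `|evale w s e1| (evale w s e2)) -> wp (Put e1 e2) s 1 Q.
Proof.
move=> hb hQ hs; exists (upd s `|evale w s e1| (evale w s e2)), 1; split=> //.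
  by apply: exec_put; exact: hb.
by move=> j; rewrite /upd; case: ifP => _; [exact: hb|].
Qed.

Lemma wp_seq c1 c2 s t1 t2 Q :
  wp c1 s t1 (fun s1 => wp c2 s1 t2 Q) -> wp (Seq c1 c2) s (t1 + t2) Q.
Proof.
move=> h /h[s1 [k1 [x1 l1 b1 /(_ b1)[s2 [k2 [x2 l2 b2 q2]]]]]].
exists s2, (k1 + k2); split=> //; last exact: leq_add.
exact: exec_seq x1 x2.
Qed.

(** A while loop whose guard is determined by a counter [i]: one test per iteration, and a last one
    that fails. *)
Lemma wp_for e c (J : nat -> store -> Prop) (lo hi t : nat) s :
  (forall i s, lo <= i <= hi -> J i s -> (0 < evale w s e)%R = (i < hi)) ->
  (forall i s, lo <= i < hi -> J i s -> wp c s t (J i.+1)) ->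
  lo <= hi -> J lo s -> wp (While e c) s ((hi - lo) * t.+1).+1 (J hi).
Proof.
have [m] := ubnP (hi - lo); elim: m lo s => // m IH lo s lem he hc le hJ hs.
have [lt|ge] := ltnP lo hi; last first.
  have elo : lo = hi by lia.
  exists s, 1; split=> //; last by rewrite -elo.
  by apply: exec_while0; rewrite (he lo) ?leqnn//; lia.
have lolo : lo <= lo < hi by rewrite leqnn.
have [s1 [t1 [x1 l1 b1 J1]]] := hc lo s lolo hJ hs.
have [||||s2 [t2 [x2 l2 b2 J2]]] := IH lo.+1 s1 _ _ _ _ J1 b1; rewrite //; first lia.
- by move=> i s' hi'; apply: he; lia.
- by move=> i s' hi'; apply: hc; lia.
exists s2, (t1 + t2).+1; split=> //.
  by apply: exec_while1 x1 x2; rewrite (he lo) ?lt// leqnn ltnW.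
rewrite ltnS (_ : hi - lo = (hi - lo.+1).+1) ?mulSn; [move: l1 l2; lia|lia].
Qed.

Definition gv (c : nat) : expr := Get (Cst (Posz c)).
(* If b is 0 the cell a, whichever it is, gets its own value back. *)
Definition cput (a b v : expr) : stmt := Put a (eite b v (Get a)).

Lemma updE s a v j : upd s a v j = if j == a then v else s j. Proof. by []. Qed.

Lemma wp_cput a b v s (cond : bool) Q : evale w s b = (cond%:R)%R ->
  (cond -> bitlen (evale w s v) <= L) ->
  Q (if cond then upd s `|evale w s a| (evale w s v) else s) ->
  wp (cput a b v) s 1 Q.
Proof.
move=> hb hv hQ; apply: wp_put => [hs|]; rewrite (evale_eite _ _ hb).
  by case: (cond) hv => [/(_ isT)|_] //=.
case: (cond) hQ => //= hQ; rewrite (_ : upd _ _ _ = s)//.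
by apply/funext => k; rewrite updE; case: eqP => [->|].
Qed.

End wp.

(** * Enumeration of words by nested loops *)

Section nest.
Variables (w : seq int) (L n d : nat).
Definition Wc (l : nat) : nat := 4 + l.

(** The recursion of [mon_words] as code: at level [l] the letter runs from the previous letter up
    to n - 1, with n read from input cell 0. The leaves are therefore visited in the order of the
    input. *)
Fixpoint nest (leaf : stmt) (k l : nat) (lo : expr) : stmt :=
  if k is k'.+1 then
    Seq (Put (Cst (Posz (Wc l))) lo)
      (While (esub (InputAt (Cst 0)) (gv (Wc l)))
        (Seq (nest leaf k' l.+1 (gv (Wc l)))
             (Put (Cst (Posz (Wc l))) (eadd (gv (Wc l)) (Cst 1)))))
  else leaf.

Fixpoint nest_time (tl k : nat) : nat :=
  if k is k'.+1 then 1 + (n * (nest_time tl k' + 1).+1).+1 else tl.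

Lemma nest_time_le tl' k : nest_time tl' k <= (tl' + 3) * (2 * n + 2) ^ k.
Proof.
elim: k => [|k IH] /=; first by rewrite muln1 leq_addr.
rewrite expnS mulnCA; set X := (_ * _ ^ k) in IH *.
have Y0 : 0 < (2 * n + 2) ^ k by rewrite expn_gt0 addn2.
have X3 : 3 <= X by rewrite /X (leq_trans (leq_addl tl' 3))// leq_pmulr.
nia.
Qed.

Hypothesis (w0 : nth 0%R w 0 = Posz n).
Hypothesis (nL : bitlen (Posz n) <= L).

Variables (leaf : stmt) (K tl : nat) (WS : seq (seq nat)).
(** The argument is the list of words already treated. That it stays a prefix of [WS] identifies the
    current word with the entry of [WS] at position [size done], to which the input pointer
    refers. *)
Variable Inv : seq (seq nat) -> store -> Prop.
Hypothesis K_le : K <= d.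
Hypothesis Inv_upd : forall done s l z, l < d -> Inv done s -> Inv done (upd s (Wc l) z).
Hypothesis leafP : forall done u s, size u = K -> prefix (rcons done u) WS ->
  (forall i, i < K -> s (Wc i) = Posz (nth 0 u i)) -> Inv done s ->
  wp w L leaf s tl (fun s' => Inv (rcons done u) s' /\
    forall i, i < d -> s' (Wc i) = s (Wc i)).

Lemma bitlen_le_n (i : nat) : i <= n -> bitlen (Posz i) <= L.
Proof.
move=> h; apply: leq_trans nL; rewrite /bitlen ltnS /=; exact: leq_trunc_log.
Qed.

Lemma nestP k l pre lo lov s done :
  l + k = K -> size pre = l ->
  (forall i, i < l -> s (Wc i) = Posz (nth 0 pre i)) ->
  evale w s lo = Posz lov -> lov <= n ->
  prefix (done ++ [seq pre ++ v | v <- mon_words n lov k]) WS -> Inv done s ->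
  wp w L (nest leaf k l lo) s (nest_time tl k)
    (fun s' => Inv (done ++ [seq pre ++ v | v <- mon_words n lov k]) s' /\
      forall i, i < l -> s' (Wc i) = s (Wc i)).
Proof.
elim: k l pre lo lov s done => [|k IH] l pre lo lov s done.
  rewrite addn0 => lK sp hpre _ _; rewrite /= cats0 cats1 => hpr hI.
  have hu : forall i, i < K -> s (Wc i) = Posz (nth 0 pre i) by rewrite -lK.
  have sK : size pre = K by rewrite sp.
  apply: wp_weaken (leafP sK hpr hu hI) => // s' [h1 h2].
  by split=> // i il; apply: h2; lia.
move=> lK sp hpre hlo lov_le hpr hI /=.
have ld : l < d by lia.
apply: wp_seq; apply: wp_put => [_|]; first by rewrite hlo bitlen_le_n.
rewrite hlo /=; set s1 := upd _ _ _.
have I1 : Inv done s1 by exact: Inv_upd.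
(* The words with prefix [pre] whose next letter is in lov .. i - 1: those treated when the loop
   variable reaches i. *)
pose D i := flatten [seq [seq pre ++ j :: v | v <- mon_words n j k] | j <- iota lov (i - lov)].
have DS i : lov <= i -> D i.+1 = D i ++ [seq pre ++ i :: v | v <- mon_words n i k].
  move=> hi; rewrite /D subSn// -addn1 iotaD map_cat flatten_cat /= cats0.
  by rewrite subnKC.
have Dn : [seq pre ++ v | v <- flatten [seq [seq i :: w | w <- mon_words n i k] |
    i <- iota lov (n - lov)]] = D n.
  rewrite /D map_flatten -map_comp; congr flatten; apply: eq_map => j /=.
  by rewrite -map_comp.
rewrite Dn in hpr *.
pose J i s' := [/\ s' (Wc l) = Posz i, Inv (done ++ D i) s' &
   forall i, i < l -> s' (Wc i) = s (Wc i)].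
apply: (@wp_weaken _ _ _ _ _ _ (J n)); last first.
- apply: (@wp_for _ _ _ _ J lov n (nest_time tl k + 1)) => //; first last.
  + split; [by rewrite /s1 updE eqxx|by rewrite /D subnn cats0|].
    by move=> i il; rewrite /s1 updE ifF//; apply/eqP; rewrite /Wc; lia.
  + move=> i s' /andP[hi1 hi2] [e1 hI' fr]; apply: wp_seq.
    have pre_i : prefix ((done ++ D i) ++ [seq rcons pre i ++ v | v <- mon_words n i k]) WS.
      apply: prefix_trans hpr; rewrite (_ : [seq rcons pre i ++ v | v <- _] =
        [seq pre ++ i :: v | v <- mon_words n i k]); last first.
        by apply: eq_map => v; rewrite cat_rcons.
      rewrite -catA -DS// /D -(subnKC (_ : i.+1 - lov <= n - lov)); last lia.
      rewrite iotaD map_cat flatten_cat !catA; exact: prefix_prefix.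
    apply: wp_weaken (IH l.+1 (rcons pre i) (gv (Wc l)) i s' (done ++ D i)
      _ _ _ _ _ pre_i hI').
    * exact: leqnn.
    * move=> s2 [hI2 fr2]; apply: wp_put => [_|].
        by rewrite /= fr2// e1 -PoszD bitlen_le_n// addn1.
      rewrite /= fr2// e1 -PoszD addn1; split.
      - by rewrite updE eqxx.
      - apply: Inv_upd => //; rewrite DS// catA.
        rewrite (_ : [seq pre ++ i :: v | v <- _] =
          [seq rcons pre i ++ v | v <- mon_words n i k])//.
        by apply: eq_map => v; rewrite cat_rcons.
      - move=> j jl; rewrite updE ifF; last by apply/eqP; rewrite /Wc; lia.
        by rewrite fr2 ?fr//; lia.
    * by rewrite addSnnS.
    * by rewrite size_rcons sp.
    * move=> j; rewrite ltnS leq_eqVlt => /orP[/eqP ->|jl].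
        by rewrite e1 nth_rcons sp ltnn eqxx.
      by rewrite fr// nth_rcons sp jl; apply: hpre.
    * by rewrite /= e1.
    * exact: ltnW.
  + by move=> i s' hi [e1 _ _] /=; rewrite w0 e1 subr_gt0.
- by move=> s' [_ h1 h2].
- by rewrite ltnS leq_mul2r leq_subr orbT.
Qed.

End nest.

Local Open Scope nat_scope.

(** * The program *)

Lemma bitlen_bool (b : bool) : bitlen (b%:R)%R = 1.
Proof. by case: b. Qed.

Section program.
Variable d : nat.

(* Cells: result, candidate I, input pointer, outcome of the tests for I, then
   the letters Wc l of the current word, and numerators and denominators of the
   derivative along x_I^k (Hc k) and along x_I^(d-1) x_j (Ac j). *)
Definition RES := 0.
Definition CI := 1.
Definition PTR := 2.
Definition OK := 3.
Definition Hc (k : nat) : nat := 4 + d + 2 * k.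
Definition Ac (j : nat) : nat := 4 + d + 2 * d.+1 + 2 * j.

Definition cst (k : nat) : expr := Cst (Posz k).
Definition eN : expr := InputAt (gv PTR).
Definition eD : expr := InputAt (eadd (gv PTR) (cst 1)).
Definition eFac (k : nat) : expr :=
  eprod [seq esum [seq eeq (gv (Wc i)) (gv (Wc l)) | i <- index_iota 0 l.+1]
        | l <- index_iota 0 k].
Definition eFN (k : nat) : expr := emul eN (eFac k).
Definition eAll (k : nat) : expr :=
  eprod [seq eeq (gv (Wc l)) (gv CI) | l <- index_iota 0 k].
Definition eCount : expr := esum [seq eeq (gv (Wc l)) (gv CI) | l <- index_iota 0 d].
(** The test count + 2 > d says that at least d - 1 letters equal I. *)
Definition eSpike (k : nat) : expr :=
  if k == d then IsPos (esub (eadd eCount (cst 2)) (cst d)) else cst 0.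
(* The letters of the word of x_I^(d-1) x_j sum up to (d-1) I + j. *)
Definition eJ : expr :=
  esub (esum [seq gv (Wc l) | l <- index_iota 0 d]) (emul (cst d.-1) (gv CI)).
Definition eA (b : nat) (e : expr) : expr := eadd (cst (Ac 0 + b)) (emul (cst 2) e).

(** Every word is tested for both tables, since x_I^d belongs to both: as x_I^k with k = d and as
    x_I^(d-1) x_j with j = I. *)
Definition leaf2 (k : nat) : stmt :=
  Seq (cput (cst (Hc k)) (eAll k) (eFN k))
  (Seq (cput (cst (Hc k).+1) (eAll k) eD)
  (Seq (cput (eA 0 eJ) (eSpike k) (eFN k))
  (Seq (cput (eA 1 eJ) (eSpike k) eD)
  (Put (cst PTR) (eadd (gv PTR) (cst 2)))))).

Definition eAN (e : expr) : expr := Get (eA 0 e).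
Definition eAD (e : expr) : expr := Get (eA 1 e).

(** The products in [eLhs] and [eRhs] live in temporaries only; what gets stored is the outcome of
    their comparison. *)
Definition eLhs (k : nat) : expr :=
  emul (emul (eFN k) (eprod (nseq k (eAN (gv CI)))))
       (emul (gv (Hc k).+1) (eprod [seq eAD (gv (Wc l)) | l <- index_iota 0 k])).
Definition eRhs (k : nat) : expr :=
  emul (emul (gv (Hc k)) (eprod [seq eAN (gv (Wc l)) | l <- index_iota 0 k]))
       (emul eD (eprod (nseq k (eAD (gv CI))))).

Definition leaf3 (k : nat) : stmt :=
  Seq (Put (cst OK) (emul (gv OK) (eeq (eLhs k) (eRhs k))))
      (Put (cst PTR) (eadd (gv PTR) (cst 2))).

Definition pass (leaf : nat -> stmt) (c : stmt) : stmt :=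
  Seq (Put (cst PTR) (cst 1))
    (foldr (fun k => Seq (nest (leaf k) k 0 (cst 0))) c (iota 0 d.+1)).

(** [eroot] is evaluated for every I but only meaningful if B_I <> 0; otherwise [OK] is already 0
    and the product discards its value. The first pass overwrites all table entries left by the
    previous I. *)
Definition body (eroot : expr) : stmt :=
  pass leaf2 (Seq (Put (cst OK) (esub (cst 1) (eeq (eAN (gv CI)) (cst 0))))
  (pass leaf3 (Seq (Put (cst OK) (emul (gv OK) eroot))
  (Seq (Put (cst RES) (IsPos (eadd (gv RES) (gv OK))))
       (Put (cst CI) (eadd (gv CI) (cst 1))))))).

Definition decider (eroot : expr) : stmt :=
  Seq (Put (cst CI) (cst 0)) (While (esub (InputAt (cst 0)) (gv CI)) (body eroot)).

(** * Correctness of the program for one candidate I *)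

Variables (n : nat) (p : mpoly n rat) (L : nat).
Hypothesis d_gt0 : 0 < d.

Let w := encode_poly d p.
(** A stored numerator is an input number times a multi-index factorial of at most d!, which
    accounts for d! + 1 further bits. The input pointer is bounded by the number of input cells, up
    to a constant. *)
Hypothesis L_ge : input_size w + d`! + 4 <= L.

Definition FN (u : seq nat) : int := (numq (word_coef p u) * Posz (fact_word u))%R.
Definition FD (u : seq nat) : int := denq (word_coef p u).

Local Notation WS := (words n d).

Lemma input_le i : bitlen (nth 0%R w i) <= input_size w.
Proof. by apply: bitlen_nth; rewrite /w size_encode. Qed.

Lemma bitlen_w0 : bitlen (Posz n) <= L.
Proof. by have := input_le 0; rewrite nth_encode0; move: L_ge; lia. Qed.

Lemma prefix_nth (done : seq (seq nat)) u : prefix (rcons done u) WS ->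
  size done < size WS /\ nth [::] WS (size done) = u.
Proof.
case/prefixP => v ->; rewrite size_cat size_rcons; split; first by lia.
by rewrite nth_cat size_rcons ltnSn nth_rcons ltnn eqxx.
Qed.

Variable I : nat.
Hypothesis I_lt : I < n.

Definition input_state (done : seq (seq nat)) (u : seq nat) (s : store) : Prop :=
  [/\ s PTR = Posz (1 + (size done).*2), s CI = Posz I &
      forall i, i < size u -> s (Wc i) = Posz (nth 0 u i)].

Section evaluation.
Variables (done : seq (seq nat)) (u : seq nat) (s : store).
Hypotheses (hs : input_state done u s) (hu : prefix (rcons done u) WS).

Lemma u_words : u \in WS.
Proof. by have [h <-] := prefix_nth hu; apply: mem_nth. Qed.

Lemma evale_eN : evale w s eN = numq (word_coef p u).
Proof.
case: hs => h _ _; have [h1 h2] := prefix_nth hu.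
by have [e _] := nth_encode p h1; rewrite [LHS]/= h /w [absz _]/= e h2.
Qed.

Lemma evale_eD : evale w s eD = FD u.
Proof.
case: hs => h _ _; have [h1 h2] := prefix_nth hu.
have [_ e] := nth_encode p h1; rewrite /FD -h2 -e [LHS]/= h -PoszD.
by congr nth; lia.
Qed.

Lemma evale_eFac : evale w s (eFac (size u)) = Posz (fact_word u).
Proof.
case: hs => _ _ h; rewrite evale_eprod big_map /fact_word -[RHS]natz natr_prod.
apply: eq_big_nat => l /andP[_ lu]; rewrite evale_esum big_map natr_sum.
apply: eq_big_nat => i /andP[_ il]; rewrite evale_eeq /= !h//.
by apply: leq_trans il _.
Qed.

Lemma evale_eFN : evale w s (eFN (size u)) = FN u.
Proof. by rewrite /FN -evale_eN -evale_eFac. Qed.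

Lemma evale_eAll : evale w s (eAll (size u)) = ((u == nseq (size u) I)%:R)%R.
Proof.
case: hs => _ hI h; rewrite evale_eprod big_map.
rewrite (eq_big_nat _ _ (F2 := fun l => ((nth 0 u l == I)%:R)%R)); last first.
  by move=> l /andP[_ lu]; rewrite evale_eeq /= hI h.
rewrite -(big_nth 0 xpredT (fun x => ((x == I)%:R : int)%R)).
elim: (u) => [|x v IH]; first by rewrite big_nil.
by rewrite big_cons IH /= eqseq_cons; case: (x == I); rewrite ?mul1r ?mul0r.
Qed.

Lemma evale_eSpike :
  evale w s (eSpike (size u)) = (((size u == d) && (d.-1 <= count_mem I u)%N)%:R)%R.
Proof.
case: hs => _ hI h; rewrite /eSpike; case: eqP => // sd.
have e : evale w s eCount = Posz (count_mem I u).
  rewrite evale_esum big_map -sd.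
  rewrite (eq_big_nat _ _ (F2 := fun l => ((nth 0 u l == I)%:R)%R)); last first.
    by move=> l /andP[_ lu]; rewrite evale_eeq /= hI h.
  rewrite -(big_nth 0 xpredT (fun x => ((x == I)%:R : int)%R)) -[RHS]natz -sum1_count natr_sum.
  by rewrite [RHS]big_mkcond; apply: eq_bigr => x _ /=; case: (x == I).
rewrite [LHS]/= -/(eadd _ _) e.
rewrite (_ : (0 < _)%R = (d.-1 <= count_mem I u)); last by clear hu; lia.
by case: ifP.
Qed.

Definition spike_letter : nat := \sum_(x <- u) x - d.-1 * I.

Lemma spike_letterP : size u = d -> d.-1 <= count_mem I u ->
  [/\ spike_letter < n, u = spike d I spike_letter &
      forall b, `|evale w s (eA b eJ)| = Ac spike_letter + b].
Proof.
move=> sd hc; case: hs => _ hI h.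
have := u_words; rewrite mem_words => /and3P[_ so au].
have [j ju [uE sE]] := spike_of_count d_gt0 sd so hc.
have -> : spike_letter = j by rewrite /spike_letter sE addnK.
split=> // [|b]; first by have /allP := au; apply.
have e : evale w s (esum [seq gv (Wc l) | l <- index_iota 0 d]) = Posz (\sum_(x <- u) x).
  rewrite evale_esum big_map -sd -[RHS]natz natr_sum [RHS](big_nth 0).
  by apply: eq_big_nat => l /andP[_ lu]; rewrite /= h// natz.
rewrite /eA /eJ; rewrite [evale _ _ _]/= -/(esum _) e sE hI /Ac.
by lia.
Qed.

Lemma bitlen_FN : bitlen (FN u) <= L.
Proof.
have := u_words; rewrite mem_words => /and3P[ud _ _].
apply: leq_trans (bitlenM _ _) _.
have : bitlen (Posz (fact_word u)) <= (d`!).+1.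
  apply: leq_trans (bitlen_nat _) _; rewrite ltnS.
  by apply: leq_trans (fact_word_le u) _; apply: leq_fact.
have [h1 h2] := prefix_nth hu.
have [] := nth_encode p h1; rewrite h2 => <- _; have := input_le (1 + (size done).*2).
by rewrite -/w; move: L_ge; lia.
Qed.

Lemma bitlen_FD : bitlen (FD u) <= L.
Proof.
have [h1 h2] := prefix_nth hu.
have [_] := nth_encode p h1; rewrite h2 /FD => <-; have := input_le (2 + (size done).*2).
by rewrite -/w; move: L_ge; lia.
Qed.

Lemma bitlen_ptr : bitlen (Posz (1 + (size done).*2 + 2)) <= L.
Proof.
have [h1 h2] := prefix_nth hu; apply: leq_trans (bitlen_nat _) _.
by have := size_le_input w; rewrite /w size_encode -/w; move: L_ge; lia.
Qed.

End evaluation.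

Lemma input_state_upd done u s c v : size u <= d -> 4 + d <= c ->
  input_state done u s -> input_state done u (upd s c v).
Proof.
move=> ud hc [h1 h2 h3]; split; rewrite ?updE.
- by rewrite ifF// /PTR; apply/eqP; lia.
- by rewrite ifF// /CI; apply/eqP; lia.
- by move=> i iu; rewrite updE h3// ifF// /Wc; apply/eqP; lia.
Qed.

(** The tables are correct for the words in [T]: those read so far during the first pass, all of
    [words n d] afterwards. *)
Definition recorded (T : pred (seq nat)) (s : store) : Prop :=
  (forall k, k <= d -> T (nseq k I) ->
     s (Hc k) = FN (nseq k I) /\ s (Hc k).+1 = FD (nseq k I)) /\
  (forall j, j < n -> T (spike d I j) ->
     s (Ac j) = FN (spike d I j) /\ s (Ac j).+1 = FD (spike d I j)).

Definition Inv2 (res : int) (done : seq (seq nat)) (s : store) : Prop :=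
  [/\ s PTR = Posz (1 + (size done).*2), s CI = Posz I, s RES = res &
      recorded (mem done) s].

Lemma spike_spike (u : seq nat) j : j < n -> u = spike d I j ->
  (size u == d) && (d.-1 <= count_mem I u)%N /\ spike_letter u = j.
Proof.
move=> jn ->; have pu : perm_eq (spike d I j) (j :: nseq d.-1 I) by rewrite perm_sort.
rewrite size_spike// eqxx (permP pu) /= count_nseq /= eqxx mul1n leq_addl; split=> //.
by rewrite /spike_letter (perm_big _ pu) big_cons /= big_nseq iter_addn_0 mulnC addnK.
Qed.

Lemma leaf2P res k done u s : k <= d -> size u = k ->
  prefix (rcons done u) WS ->
  (forall i, i < k -> s (Wc i) = Posz (nth 0 u i)) -> Inv2 res done s ->
  wp w L (leaf2 k) s 5 (fun s' => Inv2 res (rcons done u) s' /\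
    forall i, i < d -> s' (Wc i) = s (Wc i)).
Proof.
move=> kd <- hu hW [hptr hI hres [hH hA]].
have ud : size u <= d.
  by have := u_words hu; rewrite mem_words => /and3P[].
have hs : input_state done u s by [].
pose b1 := u == nseq (size u) I.
pose b2 := (size u == d) && (d.-1 <= count_mem I u)%N.
pose s1 := if b1 then upd s (Hc (size u)) (FN u) else s.
have hs1 : input_state done u s1.
  by rewrite /s1; case: (b1) => //; apply: input_state_upd => //; rewrite /Hc; lia.
pose s2 := if b1 then upd s1 (Hc (size u)).+1 (FD u) else s1.
have hs2 : input_state done u s2.
  by rewrite /s2; case: (b1) => //; apply: input_state_upd => //; rewrite /Hc; lia.
pose j := spike_letter u.
have jP : b2 -> j < n /\ u = spike d I j.
  by case/andP => /eqP sd hc; have [] := spike_letterP hs hu sd hc.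
have aP s' b : input_state done u s' -> b2 -> `|evale w s' (eA b eJ)| = Ac j + b.
  by move=> hs' /andP[/eqP sd hc]; have [] := spike_letterP hs' hu sd hc.
pose s3 := if b2 then upd s2 (Ac j) (FN u) else s2.
have hs3 : input_state done u s3.
  by rewrite /s3; case: (b2) => //; apply: input_state_upd => //; rewrite /Ac; lia.
pose s4 := if b2 then upd s3 (Ac j).+1 (FD u) else s3.
have hs4 : input_state done u s4.
  by rewrite /s4; case: (b2) => //; apply: input_state_upd => //; rewrite /Ac; lia.
apply: (@wp_seq _ _ _ _ _ 1 4); apply: (wp_cput (evale_eAll hs)).
  by rewrite (evale_eFN hs hu) => _; exact: bitlen_FN hu.
rewrite (evale_eFN hs hu) -/b1 -/s1.
apply: (@wp_seq _ _ _ _ _ 1 3); apply: (wp_cput (evale_eAll hs1)).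
  by rewrite (evale_eD hs1 hu) => _; exact: bitlen_FD hu.
rewrite (evale_eD hs1 hu) -/b1 -/s2.
apply: (@wp_seq _ _ _ _ _ 1 2); apply: (wp_cput (evale_eSpike hs2)).
  by rewrite (evale_eFN hs2 hu) => _; exact: bitlen_FN hu.
rewrite (evale_eFN hs2 hu) -/b2 (_ : (if b2 then _ else _) = s3); last first.
  by rewrite /s3; have := aP s2 0 hs2; case: (b2) => // ->//; rewrite addn0.
apply: (@wp_seq _ _ _ _ _ 1 1); apply: (wp_cput (evale_eSpike hs3)).
  by rewrite (evale_eD hs3 hu) => _; exact: bitlen_FD hu.
rewrite (evale_eD hs3 hu) -/b2 (_ : (if b2 then _ else _) = s4); last first.
  by rewrite /s4; have := aP s3 1 hs3; case: (b2) => // ->//; rewrite addn1.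
have e4 : evale w s4 (eadd (gv PTR) (cst 2)) = Posz (1 + (size done).*2 + 2).
  by case: hs4 => /= -> _ _.
apply: wp_put; rewrite e4; first by move=> _; exact: bitlen_ptr hu.
have low c : c < 4 + d -> s4 c = s c.
  rewrite /s4 /s3 /s2 /s1 /Hc /Ac => hc.
  by case: (b1); case: (b2); rewrite ?updE; do ?[rewrite ifF; last by apply/eqP; lia].
(* Here and below, c = 0 selects the numerators and c = 1 the denominators. *)
have eH c : c < 2 -> forall k', k' <= d -> s4 (Hc k' + c) =
    if b1 && (k' == size u) then (if c == 0 then FN u else FD u) else s (Hc k' + c).
  move=> c2 k' hk'.
  have -> : s4 (Hc k' + c) = s2 (Hc k' + c).
    rewrite /s4 /s3 /Hc /Ac; case: (b2); rewrite ?updE//.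
    by do ?[rewrite ifF; last by apply/eqP; lia].
  rewrite /s2 /s1 /Hc; case: (b1); rewrite /= ?updE//.
  case: eqVneq => e1; first by rewrite ifT ?ifF//; lia.
  by case: eqVneq => e2; case: eqVneq => e3; rewrite ?ifT ?ifF//; lia.
have eA_ c : c < 2 -> forall j', s4 (Ac j' + c) =
    if b2 && (j' == j) then (if c == 0 then FN u else FD u) else s (Ac j' + c).
  move=> c2 j'.
  have e2 : s2 (Ac j' + c) = s (Ac j' + c).
    rewrite /s2 /s1 /Hc /Ac; case: (b1); rewrite ?updE//.
    by do ?[rewrite ifF; last by apply/eqP; lia].
  rewrite /s4 /s3 /Ac; case: (b2); rewrite /= ?updE -?e2//.
  case: eqVneq => e1; first by rewrite ifT ?ifF//; lia.
  by case: eqVneq => e4'; case: eqVneq => e3; rewrite ?ifT ?ifF//; lia.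
have s5E c : c != PTR ->
    upd s4 `|evale w s4 (cst PTR)| (Posz (1 + (size done).*2 + 2)) c = s4 c.
  by move=> hc; rewrite updE /= ifN.
have bigP c : 3 < c -> c != PTR by move=> c3; apply/eqP; rewrite /PTR; lia.
split; last by move=> i id; rewrite s5E ?bigP /Wc ?low//; lia.
split.
- by rewrite updE [absz _]/= eqxx size_rcons doubleS -addnA addn2.
- by rewrite s5E// low.
- by rewrite s5E// low.
split=> [k' hk'|j' hj']; rewrite /= mem_rcons in_cons => hin.
- rewrite !s5E ?bigP ?/Hc//.
  have := eH 0 isT k' hk'; have := eH 1 isT k' hk'; rewrite /= addn0 addn1 => -> ->.
  case: ifP => [/andP[/eqP e1 /eqP ->]|ne]; first by rewrite -e1.
  case/orP: hin => [/eqP e|]; last exact: hH.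
  by move: ne; rewrite /b1 -e size_nseq !eqxx.
- rewrite !s5E ?bigP ?/Ac//.
  have := eA_ 0 isT j'; have := eA_ 1 isT j'; rewrite /= addn0 addn1 => -> ->.
  case: ifP => [/andP[/jP[_ uE] /eqP ->]|ne]; first by rewrite -uE.
  case/orP: hin => [/eqP e|]; last exact: hA.
  have [b2u ju] := spike_spike hj' (esym e).
  by move: ne; rewrite /b2 /j b2u ju eqxx.
Qed.

(* tay u * B_I^k = tay I^k * prod_(x <- u) B_x, k = size u, cleared of
   denominators *)
Definition check (u : seq nat) : bool :=
  (FN u * FN (spike d I I) ^+ size u *
     (FD (nseq (size u) I) * \prod_(x <- u) FD (spike d I x)) ==
   FN (nseq (size u) I) * \prod_(x <- u) FN (spike d I x) *
     (FD u * FD (spike d I I) ^+ size u))%R.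

Definition Inv3 (res : int) (b : bool) (done : seq (seq nat)) (s : store) : Prop :=
  [/\ s PTR = Posz (1 + (size done).*2), s CI = Posz I, s RES = res,
      recorded (mem WS) s & s OK = ((b && all check done)%:R)%R].

Lemma evale_eprod_nseq s k e : evale w s (eprod (nseq k e)) = (evale w s e ^+ k)%R.
Proof.
by rewrite evale_eprod big_nseq -Monoid.iteropE.
Qed.

Lemma evale_recorded s e j : recorded (mem WS) s -> evale w s e = Posz j -> j < n ->
  evale w s (eAN e) = FN (spike d I j) /\ evale w s (eAD e) = FD (spike d I j).
Proof.
move=> [_ hA] he jn; have [hN hD] := hA j jn (spike_words d_gt0 I_lt jn).
rewrite -hN -hD /eAN /eAD; split; rewrite [LHS]/= he; congr s; rewrite /Ac; lia.
Qed.

Lemma leaf3P res b k done u s : k <= d -> size u = k ->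
  prefix (rcons done u) WS ->
  (forall i, i < k -> s (Wc i) = Posz (nth 0 u i)) -> Inv3 res b done s ->
  wp w L (leaf3 k) s 2 (fun s' => Inv3 res b (rcons done u) s' /\
    forall i, i < d -> s' (Wc i) = s (Wc i)).
Proof.
move=> kd <- hu hW [hptr hI hres hrec hok].
have := u_words hu; rewrite mem_words => /and3P[ud _ /allP au].
have hs : input_state done u s by [].
have [eNI eDI] := evale_recorded hrec (hI : evale w s (gv CI) = Posz I) I_lt.
have [hNk hDk] := hrec.1 (size u) ud (nseq_words I_lt ud).
have hW' l : l < size u -> evale w s (eAN (gv (Wc l))) = FN (spike d I (nth 0 u l)) /\
    evale w s (eAD (gv (Wc l))) = FD (spike d I (nth 0 u l)).
  by move=> lu; apply: evale_recorded => //=; [exact: hW|apply: au; rewrite mem_nth].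
have eL : evale w s (eLhs (size u)) = (FN u * FN (spike d I I) ^+ size u *
     (FD (nseq (size u) I) * \prod_(x <- u) FD (spike d I x)))%R.
  rewrite -[LHS]/((evale w s (eFN (size u)) * evale w s (eprod (nseq _ _))) *
    (s (Hc (size u)).+1 * evale w s (eprod (map _ _))))%R.
  rewrite (evale_eFN hs hu) evale_eprod_nseq eNI hDk.
  congr (_ * (_ * _))%R; rewrite evale_eprod big_map [RHS](big_nth 0).
  by apply: eq_big_nat => l /andP[_ /hW'[_ ->]].
have eR : evale w s (eRhs (size u)) = (FN (nseq (size u) I) * \prod_(x <- u) FN (spike d I x) *
     (FD u * FD (spike d I I) ^+ size u))%R.
  rewrite -[LHS]/((s (Hc (size u)) * evale w s (eprod (map _ _))) *
    (evale w s eD * evale w s (eprod (nseq _ _))))%R.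
  rewrite (evale_eD hs hu) evale_eprod_nseq eDI hNk.
  congr (_ * _ * _)%R; rewrite evale_eprod big_map [RHS](big_nth 0).
  by apply: eq_big_nat => l /andP[_ /hW'[-> _]].
have e1 : evale w s (emul (gv OK) (eeq (eLhs (size u)) (eRhs (size u)))) =
    ((b && all check (rcons done u))%:R)%R.
  have := evale_eeq w s (eLhs (size u)) (eRhs (size u)); rewrite eL eR => eE.
  transitivity (s OK * evale w s (eeq (eLhs (size u)) (eRhs (size u))))%R; first by [].
  rewrite eE -/(check u) hok all_rcons.
  by case: (b); case: (check u); case: all; rewrite ?mulr1 ?mulr0 ?mul0r.
apply: (@wp_seq _ _ _ _ _ 1 1); apply: wp_put; rewrite e1.
  by move=> _; rewrite bitlen_bool; move: L_ge; lia.
set s1 := upd _ _ _.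
have e2 : evale w s1 (eadd (gv PTR) (cst 2)) = Posz (1 + (size done).*2 + 2).
  by rewrite /= /s1 updE /= hptr.
apply: wp_put; rewrite e2; first by move=> _; exact: bitlen_ptr hu.
have s2E c : c != PTR -> c != OK ->
    upd s1 `|evale w s1 (cst PTR)| (Posz (1 + (size done).*2 + 2)) c = s c.
  by move=> c1 c2; rewrite updE /= ifN// /s1 updE /= ifN.
have bigP c : 3 < c -> (c != PTR) && (c != OK).
  by move=> c3; apply/andP; split; apply/eqP; rewrite /PTR /OK; lia.
have s2E' c : 3 < c ->
    upd s1 `|evale w s1 (cst PTR)| (Posz (1 + (size done).*2 + 2)) c = s c.
  by move=> /bigP/andP[c1 c2]; exact: s2E.
split; last by move=> i id; apply: s2E'.
split.
- by rewrite updE [absz _]/= eqxx size_rcons doubleS -addnA addn2.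
- by rewrite s2E.
- by rewrite s2E.
- split=> [k' hk' hin|j' hj' hin].
    by rewrite !s2E' ?/Hc//; exact: hrec.1.
  by rewrite !s2E' ?/Ac//; exact: hrec.2.
- by rewrite updE /= /s1 updE.
Qed.

(** One nest for each degree 0 .. d, all bounded as if they had the full depth d. *)
Definition pass_time (tl : nat) : nat := 1 + d.+1 * ((tl + 3) * (2 * n + 2) ^ d).

Lemma passP leaf (Inv : seq (seq nat) -> store -> Prop) tl c tc Q s :
  (forall done s l z, l < d -> Inv done s -> Inv done (upd s (Wc l) z)) ->
  (forall k done u s, k <= d -> size u = k -> prefix (rcons done u) WS ->
    (forall i, i < k -> s (Wc i) = Posz (nth 0 u i)) -> Inv done s ->
    wp w L (leaf k) s tl (fun s' => Inv (rcons done u) s' /\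
      forall i, i < d -> s' (Wc i) = s (Wc i))) ->
  Inv [::] (upd s PTR 1%R) -> (forall s', Inv WS s' -> wp w L c s' tc Q) ->
  wp w L (pass leaf c) s (pass_time tl + tc) Q.
Proof.
move=> Inv_upd leafP hI hc; rewrite /pass /pass_time -addnA.
apply: wp_seq; apply: wp_put => [_|]; first by rewrite (bitlen_bool true); move: L_ge; lia.
rewrite [absz _]/= [evale _ _ _]/=; set X := (_ * _ ^ d).
pose F m := flatten [seq mon_words n 0 k | k <- iota 0 m].
suff main j m s' : m + j = d.+1 -> Inv (F m) s' ->
    wp w L (foldr (fun k => Seq (nest (leaf k) k 0 (cst 0))) c (iota m j)) s' (j * X + tc) Q.
  exact: (main d.+1 0).
elim: j m s' => [|j IH] m s' mj hI' /=.
  by apply: hc; rewrite addn0 in mj; rewrite mj in hI'.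
have md : m <= d by lia.
have FS : F m.+1 = F m ++ [seq [::] ++ v | v <- mon_words n 0 m].
  by rewrite /F -addn1 iotaD map_cat flatten_cat /= cats0 add0n map_id.
have hpr : prefix (F m ++ [seq [::] ++ v | v <- mon_words n 0 m]) WS.
  rewrite -FS /words -(subnKC (_ : m.+1 <= d.+1))// iotaD map_cat flatten_cat.
  exact: prefix_prefix.
rewrite mulSn -addnA; apply: wp_seq.
apply: (@wp_weaken _ _ _ _ (nest_time n tl m)); last first.
- apply: (nestP (K := m) (d := d) (Inv := Inv) (WS := WS) (leaf := leaf m)
      (nth_encode0 d p) bitlen_w0 md Inv_upd _ _ _ _ _ _ hpr hI') => //.
  by move=> done u s2 su hu hW; exact: leafP.
- move=> s2 [hI2 _]; apply: IH; first by lia.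
  by rewrite FS.
apply: leq_trans (nest_time_le n tl m) _.
by rewrite leq_mul2l leq_pexp2l ?orbT// addn2.
Qed.

Lemma recorded_upd T s c v : c < 4 + d -> recorded T s -> recorded T (upd s c v).
Proof.
move=> hc [hH hA]; split=> [k kd /(hH k kd)|j jn /(hA j jn)] [<- <-].
  by rewrite !updE !ifF//; apply/eqP; rewrite /Hc; lia.
by rewrite !updE !ifF//; apply/eqP; rewrite /Ac; lia.
Qed.

Lemma Inv2_upd res done s l z : l < d -> Inv2 res done s ->
  Inv2 res done (upd s (Wc l) z).
Proof.
by move=> ld [h1 h2 h3 h4]; split=> //; apply: recorded_upd => //; rewrite /Wc; lia.
Qed.

Lemma Inv3_upd res b done s l z : l < d -> Inv3 res b done s ->
  Inv3 res b done (upd s (Wc l) z).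
Proof.
by move=> ld [h1 h2 h3 h4 h5]; split=> //; apply: recorded_upd => //; rewrite /Wc; lia.
Qed.

Definition body_time : nat := pass_time 5 + (1 + (pass_time 2 + 3)).

Lemma bodyP eroot (nr r : bool) s :
  (forall s, recorded (mem WS) s -> FN (spike d I I) != 0%R ->
     evale w s eroot = (nr%:R)%R) ->
  s CI = Posz I -> s RES = (r%:R)%R ->
  wp w L (body eroot) s body_time (fun s' => s' CI = Posz I.+1 /\
    s' RES = ((r || [&& FN (spike d I I) != 0%R, all check WS & nr])%:R)%R).
Proof.
move=> hroot hI hr; pose b := FN (spike d I I) != 0%R.
apply: (passP (Inv := Inv2 (r%:R)%R)).
- exact: Inv2_upd.
- exact: leaf2P.
- by split=> //; split.
move=> s1 [ptr1 I1 r1 rec1].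
have [eNI _] := evale_recorded rec1 (I1 : evale w s1 (gv CI) = Posz I) I_lt.
have e1 : evale w s1 (esub (cst 1) (eeq (eAN (gv CI)) (cst 0))) = (b%:R)%R.
  have := evale_eeq w s1 (eAN (gv CI)) (cst 0); rewrite eNI => eE.
  transitivity (1 - evale w s1 (eeq (eAN (gv CI)) (cst 0)))%R; first by [].
  by rewrite eE /b /=; case: eqP.
apply: (@wp_seq _ _ _ _ _ 1); apply: wp_put; rewrite e1.
  by move=> _; rewrite bitlen_bool; move: L_ge; lia.
apply: (passP (Inv := Inv3 (r%:R)%R b)).
- exact: Inv3_upd.
- exact: leaf3P.
- split=> //.
  by rewrite updE /= updE eqxx andbT.
move=> s2 [ptr2 I2 r2 rec2 ok2].
have e2 : evale w s2 (emul (gv OK) eroot) = ([&& b, all check WS & nr]%:R)%R.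
  rewrite -[LHS]/(s2 OK * evale w s2 eroot)%R ok2.
  have [b1|b0] := boolP b; last by rewrite mul0r.
  by rewrite hroot//; case: all; rewrite /= ?mul1r ?mul0r.
apply: (@wp_seq _ _ _ _ _ 1 2); apply: wp_put; rewrite e2.
  by move=> _; rewrite bitlen_bool; move: L_ge; lia.
set g := [&& b, _ & _]; set s3 := upd _ _ _.
have e3 : evale w s3 (IsPos (eadd (gv RES) (gv OK))) = ((r || g)%:R)%R.
  by rewrite /= /s3 !updE /= r2; case: (r); case: (g).
apply: (@wp_seq _ _ _ _ _ 1 1); apply: wp_put; rewrite e3.
  by move=> _; rewrite bitlen_bool; move: L_ge; lia.
set s4 := upd _ _ _.
have e4 : evale w s4 (eadd (gv CI) (cst 1)) = Posz I.+1.
  by rewrite /= /s4 updE /= /s3 updE /= I2 -PoszD addn1.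
apply: wp_put; rewrite e4; first by move=> _; exact: (bitlen_le_n bitlen_w0).
by split; rewrite updE.
Qed.

End program.

Section decider.
Variables (d n : nat) (p : mpoly n rat) (L : nat) (eroot : expr) (nr : nat -> bool).
Hypothesis d_gt0 : 0 < d.
Let w := encode_poly d p.
Hypothesis L_ge : input_size w + d`! + 4 <= L.
Hypothesis eroot_ok : forall I s, I < n -> recorded d p I (mem (words n d)) s ->
  FN p (spike d I I) != 0%R -> evale w s eroot = ((nr I)%:R)%R.

Definition good (I : nat) : bool :=
  [&& FN p (spike d I I) != 0%R, all (check d p I) (words n d) & nr I].

Lemma deciderP : wp w L (decider d eroot) (fun=> 0%R) (n * (body_time d n).+1 + 2)
  (fun s => s RES = ((has good (iota 0 n))%:R)%R).
Proof.
rewrite addn2 -add1n; apply: wp_seq; apply: wp_put => [_|].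
  by rewrite (bitlen_bool false); move: L_ge; lia.
pose J i s := s CI = Posz i /\ s RES = ((has good (iota 0 i))%:R)%R.
apply: (@wp_weaken _ _ _ _ ((n - 0) * (body_time d n).+1).+1 _ (J n)).
- by rewrite subn0.
- by move=> s [].
apply: wp_for => //.
- by move=> i s _ [hi _] /=; rewrite hi subr_gt0 ltz_nat.
- move=> i s /andP[_ i_n] [hi hr].
  apply: wp_weaken (bodyP d_gt0 L_ge i_n (fun s => @eroot_ok i s i_n) hi hr) => //.
  move=> s' [h1 h2]; split=> //; rewrite h2 -[in RHS]addn1 iotaD has_cat /= orbF add0n.
  by congr ((_ || _)%:R)%R.
Qed.

End decider.

Local Open Scope ring_scope.

(** * Correctness and running time *)

Section correctness.
Variables (R : realType) (d n : nat) (p : mpoly n rat).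
Hypothesis d_gt0 : (0 < d)%N.

Local Notation WS := (words n d).
Let N u : rat := (FN p u)%:~R.
Let D u : rat := (FD p u)%:~R.

Lemma FD_neq0 u : D u != 0.
Proof. by rewrite /D intr_eq0 denq_neq0. Qed.

Lemma words_all u : u \in WS -> all (fun x => (x < n)%N) u.
Proof. by rewrite mem_words => /and3P[]. Qed.

Lemma tay_wordE u : u \in WS -> tay p (mnm_of_word n u) = N u / D u.
Proof. by move=> /words_all; exact: tay_word. Qed.

Lemma tayB_spike (I j : 'I_n) : tayB d p I j = N (spike d I j) / D (spike d I j).
Proof. by rewrite /tayB -mnm_of_word_spike tay_wordE// spike_words. Qed.

Lemma checkP (I : 'I_n) u : u \in WS -> check d p I u =
  (tay p (mnm_of_word n u) * tayB d p I I ^+ size u ==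
   tay p (Uk I (size u)) * \prod_j tayB d p I j ^+ mnm_of_word n u j).
Proof.
move=> uW; have ua := words_all uW.
have ud : (size u <= d)%N by move: uW; rewrite mem_words => /and3P[].
rewrite tay_wordE// tayB_spike -mnm_of_word_nseq tay_wordE ?nseq_words//.
under [X in _ == _ * X]eq_bigr do rewrite tayB_spike.
rewrite -(mnm_of_word_prod (fun x => N (spike d I x) / D (spike d I x)) ua).
rewrite big_split /= prodfV expr_div_n.
have h (a b a' b' : rat) : b != 0 -> b' != 0 ->
    (a / b == a' / b') = (a * b' == a' * b).
  by move=> b0 b0'; rewrite eqr_div.
rewrite !mulf_div h; last 2 first.
- by rewrite mulf_neq0 ?FD_neq0// expf_neq0// FD_neq0.
- by rewrite mulf_neq0 ?FD_neq0//; rewrite prodf_seq_neq0; apply/allP => x _; rewrite FD_neq0.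
rewrite /N /D /check; move: (FN p) (FD p) => f g.
by rewrite -(inj_eq (@intr_inj rat)) !rmorphM !rmorphXn !rmorph_prod /=.
Qed.

(** [mcrit] ranges over exponents, the program over words; every exponent of degree at most d comes
    from a word by [mnm_of_word_surj]. *)
Lemma all_checkP (I : 'I_n) :
  (N (spike d I I) != 0) && all (check d p I) WS <-> mcrit d p I.
Proof.
have b0 : (tayB d p I I != 0) = (N (spike d I I) != 0).
  by rewrite tayB_spike mulf_eq0 invr_eq0 (negbTE (FD_neq0 _)) orbF.
rewrite -b0; split=> [/andP[hb /allP hc]|[hb hm]].
  split=> // m md; have [u uW <-] := mnm_of_word_surj md.
  rewrite mdeg_mnm_of_word ?words_all//.
  by have := hc u uW; rewrite checkP// => /eqP.
rewrite hb; apply/allP => u uW; rewrite checkP//.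
have := words_all uW => ua; rewrite -(mdeg_mnm_of_word ua); apply/eqP/hm.
by rewrite mdeg_mnm_of_word//; move: uW; rewrite mem_words => /and3P[].
Qed.

(* Coefficients of denom I * crit_poly *)
Definition ecoef (k : nat) : expr :=
  emul (emul (gv (Hc d k.+1)) (cst ((d.-1)`! %/ k`!)%N))
       (eprod [seq gv (Hc d j).+1 | j <- index_iota 0 d.+1 & j != k.+1]).

(** A common denominator of the h^(k+1)(0) / k!: the factor (d-1)! clears the factorials, the
    product clears the derivatives along x_I. *)
Definition denom (I : nat) : int := (d.-1)`!%:Z * \prod_(0 <= j < d.+1) FD p (nseq j I).

Lemma denom_neq0 I : denom I != 0.
Proof.
rewrite mulf_neq0//; first by rewrite -lt0n fact_gt0.
by rewrite prodf_seq_neq0; apply/allP => j _; rewrite denq_neq0.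
Qed.

Lemma pv_crit (w : seq int) (I : 'I_n) s : recorded d p I (mem WS) s ->
  pv R w s d ecoef = (denom I)%:~R *: map_poly (@ratr R) (crit_poly d p I).
Proof.
move=> [hH _]; apply/polyP => k; rewrite coefZ coef_map !coef_poly.
case: ifP => kd; last by rewrite raddf0 mulr0.
have H j : (j <= d)%N -> s (Hc d j) = FN p (nseq j (I : nat)) /\
    s (Hc d j).+1 = FD p (nseq j (I : nat)).
  by move=> jd; apply: hH => //; rewrite /= nseq_words.
rewrite [X in _ = _ * X](_ : _ = ratr (tay p (Uk I k.+1)) / k`!%:R); last first.
  by rewrite /= rmorphM fmorphV rmorph_nat.
rewrite -mnm_of_word_nseq tay_wordE ?nseq_words//.
have -> : evale w s (ecoef k) = FN p (nseq k.+1 (I : nat)) * ((d.-1)`! %/ k`!)%N%:Z *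
    \prod_(0 <= j < d.+1 | j != k.+1) FD p (nseq j (I : nat)).
  transitivity (s (Hc d k.+1) * ((d.-1)`! %/ k`!)%N%:Z *
    evale w s (eprod [seq gv (Hc d j).+1 | j <- index_iota 0 d.+1 & j != k.+1])); first by [].
  rewrite (H k.+1 kd).1 evale_eprod big_map big_filter; congr (_ * _).
  rewrite big_nat_cond [RHS]big_nat_cond; apply: eq_bigr => j /andP[/andP[_ jd] _].
  exact: (H j jd).2.
have -> : denom I = (d.-1)`!%:Z * (FD p (nseq k.+1 (I : nat)) *
   \prod_(0 <= j < d.+1 | j != k.+1) FD p (nseq j (I : nat))).
  rewrite /denom; congr (_ * _); rewrite (bigD1_seq k.+1) ?iota_uniq//=.
  by rewrite mem_index_iota.
have -> : (d.-1)`!%:Z = (((d.-1)`! %/ k`!) * k`!)%N%:Z.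
  have kd' : (k <= d.-1)%N by rewrite -ltnS prednK.
  by rewrite divnK// -(bin_fact kd') mulnCA dvdn_mulr.
rewrite /N /D fmorph_div /= !ratr_int PoszM !rmorphM /=.
have k0 : k`!%:R != 0 :> R by rewrite pnatr_eq0 -lt0n fact_gt0.
have f0 : (FD p (nseq k.+1 (I : nat)))%:~R != 0 :> R by rewrite intr_eq0 denq_neq0.
rewrite (_ : (k`!%:Z)%:~R = k`!%:R :> R)//.
by field; rewrite k0 f0.
Qed.

(** This boolean is classical and serves as a specification of what [eroot] computes. Quantifying
    over the ordinals equal to [I] makes it defined for every natural number. *)
Definition noroot (I : nat) : bool := `[< forall i : 'I_n, i = I :> nat ->
  forall t : R, (map_poly (@ratr R) (crit_poly d p i)).[t] != 0 >].

Lemma eroot_correct eroot w I s :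
  (forall w s, pv R w s d ecoef != 0 ->
     evale w s eroot = (`[< forall t, (pv R w s d ecoef).[t] != 0 >])%:R) ->
  (I < n)%N -> recorded d p I (mem WS) s -> FN p (spike d I I) != 0 ->
  evale w s eroot = (noroot I)%:R.
Proof.
move=> he In; have [i iI] : exists i : 'I_n, i = I :> nat by exists (Ordinal In).
rewrite -{}iI in In * => hr hN.
have e := pv_crit w hr; have c0 : (denom i)%:~R != 0 :> R by rewrite intr_eq0 denom_neq0.
rewrite he e.
  congr (_%:R); congr nat_of_bool; apply: asbool_equiv_eq; split => [h j ji t|h t].
    have -> : j = i by exact: val_inj.
    by have := h t; rewrite hornerZ mulf_eq0 negb_or => /andP[].
  by rewrite hornerZ mulf_neq0// h.
(* The root count needs a nonzero polynomial. The coefficient of degree d - 1 of [crit_poly] is B_I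
   / (d-1)!, so B_I <> 0 is enough. *)
rewrite scaler_eq0 negb_or c0 map_poly_eq0.
apply/eqP => /(congr1 (fun q : {poly rat} => q`_d.-1)).
rewrite coef0 coef_poly prednK// leqnn => /eqP.
rewrite mulf_eq0 invr_eq0 pnatr_eq0 -leqn0 leqNgt fact_gt0 orbF => /eqP z.
case/eqP: hN; apply/eqP; rewrite -(intr_eq0 rat) -/(N _).
have : tayB d p i i == 0 by rewrite /tayB -z /Uk -mulmS prednK.
by rewrite tayB_spike mulf_eq0 invr_eq0 (negbTE (FD_neq0 _)) orbF.
Qed.

Lemma has_goodP : odd d -> mpoly.msize p = d.+1 ->
  has (good d p noroot) (iota 0 n) <-> pseudoconvex (polyfun R p).
Proof.
move=> od sp; rewrite (pseudoconvexP R od sp); split.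
  case/hasP => I; rewrite mem_iota => /andP[_ In] /and3P[h1 h2 /asboolP h3].
  exists (Ordinal In); split; last exact: h3.
  by apply/all_checkP; rewrite /N intr_eq0 h1.
move=> [I [/all_checkP/andP[h1 h2] h3]]; apply/hasP; exists (val I).
  by rewrite mem_iota /= ltn_ord.
apply/and3P; split=> //; first by rewrite /N intr_eq0 in h1.
by apply/asboolP => i /val_inj ->.
Qed.

End correctness.

Local Open Scope nat_scope.

(** * Polynomial running time *)

Definition poly_bounded (f : nat -> nat) : Prop :=
  exists c k, forall S, 0 < S -> f S <= c * S ^ k.

Lemma poly_bounded_cst c : poly_bounded (fun=> c).
Proof. by exists c, 0 => S _; rewrite muln1. Qed.

Lemma poly_bounded_id : poly_bounded id.
Proof. by exists 1, 1 => S _; rewrite mul1n expn1. Qed.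

(** For S > 0 the power S^k is nondecreasing in k, so both terms fit under the exponent k1 + k2. *)
Lemma poly_boundedD f g : poly_bounded f -> poly_bounded g ->
  poly_bounded (fun S => f S + g S).
Proof.
move=> [c1 [k1 h1]] [c2 [k2 h2]]; exists (c1 + c2), (k1 + k2) => S S0.
rewrite mulnDl leq_add//.
- by apply: leq_trans (h1 S S0) _; rewrite leq_mul2l leq_pexp2l ?orbT// leq_addr.
- by apply: leq_trans (h2 S S0) _; rewrite leq_mul2l leq_pexp2l ?orbT// leq_addl.
Qed.

Lemma poly_boundedM f g : poly_bounded f -> poly_bounded g ->
  poly_bounded (fun S => f S * g S).
Proof.
move=> [c1 [k1 h1]] [c2 [k2 h2]]; exists (c1 * c2), (k1 + k2) => S S0.
by rewrite expnD mulnACA leq_mul ?h1 ?h2.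
Qed.

Lemma poly_boundedX f m : poly_bounded f -> poly_bounded (fun S => f S ^ m).
Proof.
move=> hf; elim: m => [|m IH]; first exact: poly_bounded_cst.
have [c [k h]] := poly_boundedM hf IH; exists c, k => S S0.
by rewrite expnS; exact: h.
Qed.

(** Each variable gives a word of length 1. So n, though written in binary, is at most the input
    size, and loops up to n are affordable. *)
Lemma nvars_le_words n d : 0 < d -> n <= size (words n d).
Proof.
move=> d0; rewrite -[n in n <= _](size_iota 0) -(size_map (fun i => [:: i])).
apply: uniq_leq_size; first by rewrite map_inj_uniq ?iota_uniq// => i j [].
by move=> u /mapP[i]; rewrite mem_iota mem_words => /andP[_ ni] ->; rewrite /= ni d0.
Qed.

Lemma body_time_le d n m : 0 < d -> n <= m -> body_time d n <= body_time d m.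
Proof.
move=> d0 nm; have h tl : pass_time d n tl <= pass_time d m tl.
  rewrite /pass_time leq_add2l leq_mul2l /= leq_mul2l leq_exp2r//.
  by rewrite leq_add2r leq_mul2l nm !orbT.
by rewrite /body_time leq_add// leq_add2l leq_add2r.
Qed.

Lemma poly_bounded_body_time d : poly_bounded (body_time d).
Proof.
have h tl : poly_bounded (fun n => pass_time d n tl).
  apply: poly_boundedD; first exact: poly_bounded_cst.
  apply: poly_boundedM; first exact: poly_bounded_cst.
  apply: poly_boundedM; first exact: poly_bounded_cst.
  apply: poly_boundedX; apply: poly_boundedD; last exact: poly_bounded_cst.
  by apply: poly_boundedM; [exact: poly_bounded_cst|exact: poly_bounded_id].
apply: poly_boundedD => //; apply: poly_boundedD; first exact: poly_bounded_cst.
by apply: poly_boundedD => //; exact: poly_bounded_cst.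
Qed.

Theorem corollary2p23 (R : realType) (d : nat) (d_odd : odd d) :
  exists P : program,
    decides_in_polytime
      (fun p : poly_of_degree d => encode_poly d (poly_val p))
      (fun p : poly_of_degree d => pseudoconvex (polyfun R (poly_val p)))
      P.
Proof.
have d_gt0 : 0 < d by case: (d) d_odd.
(* The expression, the program and the constants of its time bound are all chosen before n and p are
   introduced. *)
have [eroot hroot] := expr_noroot R d (ecoef d).
have [A hA] := compileP (decider d eroot).
have [c [k hck]] : poly_bounded (fun S =>
    A * (S * (body_time d S).+1 + 2).+1 * (S + d`! + 4) ^ 2).
  apply: poly_boundedM.
    apply: poly_boundedM; first exact: poly_bounded_cst.
    have := poly_boundedD (poly_boundedM poly_bounded_id (poly_boundedD
      (poly_bounded_body_time d) (poly_bounded_cst 1))) (poly_bounded_cst 3).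
    move=> [c [k h]]; exists c, k => S S0.
    by apply: leq_trans (h S S0); rewrite addn1 addn3 addn2.
  apply: poly_boundedX; apply: poly_boundedD; last exact: poly_bounded_cst.
  by apply: poly_boundedD; [exact: poly_bounded_id|exact: poly_bounded_cst].
exists (compile (decider d eroot)), c, k => -[n p sp] /=.
set w := encode_poly d p; set S := input_size w.
have nS : n <= S.
  apply: leq_trans (nvars_le_words n d_gt0) _.
  by apply: leq_trans (size_le_input w); rewrite /w size_encode -addnn; lia.
have S0 : 0 < S by apply: leq_trans (size_le_input w); rewrite /w size_encode.
(* Linear in the input size S for fixed d, so the factor L^2 in the cost of the compiled program
   stays polynomial. *)
pose L := S + d`! + 4.
have hin i : bitlen (nth 0%R w i) <= L.
  by apply: leq_trans (bitlen_nth i _) _; rewrite ?/w ?size_encode// /L -addnA leq_addr.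
have L1 : 0 < L by rewrite /L addn4.
have s0 : sbound L (fun=> 0%R) by move=> j; rewrite (_ : bitlen _ = 1).
have nr_ok I s : I < n -> recorded d p I (mem (words n d)) s ->
    FN p (spike d I I) != 0%R -> evale w s eroot = ((noroot R d p I)%:R)%R.
  by move=> In; apply: eroot_correct => // w' s'; exact: hroot.
have [s [t [x le _ hs]]] := deciderP d_gt0 (leqnn L) nr_ok s0.
have [t' ht' le'] := hA w L s t L1 hin x.
exists t', (0 < s 0)%R; split=> //.
  apply: leq_trans le' _; apply: leq_trans (hck S S0).
  rewrite leq_mul2r leq_mul2l ltnS; apply/orP; right; apply/orP; right.
  apply: leq_trans le _; rewrite leq_add2r leq_mul// ltnS; exact: body_time_le.
rewrite -(has_goodP R d_gt0 d_odd sp) -[s 0]/(s RES) hs.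
by case: has.
Qed.
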